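(* Let $h_{ij}$ be the probability density function of $$x_{ij}(t+1)=\tfrac13\sum_{k=1}^3 p_{kj}+\tfrac13\sum_{k=1}^3 A_{kj}\,|C_{kj}p_{kj}-x_{ij}|,$$ where $p_{1j},p_{2j},p_{3j},x_{ij}$ are fixed reals and $A_{kj}\sim U[-a,a]$, $C_{kj}\sim U[0,2]$ ($k=1,2,3$) are all independent. Let $n_{kj}=a(|p_{kj}|+|x_{ij}-p_{kj}|)$, assumed positive for $k=1,2,3$, and $\sum p_j=p_{1j}+p_{2j}+p_{3j}$, $\sum n_j=n_{1j}+n_{2j}+n_{3j}$. Then $h_{ij}$ is a continuous bounded function, and $$\{u_j\in\mathbb{R}: h_{ij}(u_j)>0\}=\Bigl(\tfrac13\sum p_j-\tfrac13\sum n_j,\ \tfrac13\sum p_j+\tfrac13\sum n_j\Bigr).$$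
   Context: Setting: coordinate $j$ of one update step of the grey wolf optimizer, with $a=a(t)=2(1-t/T)>0$ at iteration $1\le t<T$; the coordinates of the three best search agents and of the current position of agent $i$ are constants. $U[p,q]$ is the uniform distribution on $[p,q]$. Densities are defined up to null sets; the statement concerns the version of $h_{ij}$ given by the (everywhere defined) scaled convolution $u\mapsto 3(g_{1j}*g_{2j}*g_{3j})(3u)$, where $g_{kj}$ is the density of $p_{kj}+A_{kj}|C_{kj}p_{kj}-x_{ij}|$. *)

(* Defs.v *)
From HB Require Import structures.
From mathcomp Require Import all_boot all_order all_algebra.
From mathcomp Require Import all_classical all_reals all_analysis.
Import Order.TTheory GRing.Theory Num.Theory numFieldNormedType.Exports.

Set Implicit Arguments.
Unset Strict Implicit.
Unset Printing Implicit Defensive.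

Local Open Scope classical_set_scope.
Local Open Scope ring_scope.

(* The product rule is required on every subfamily J of the finite family. *)
Definition mutually_independent (R : realType) (d : measure_display)
    (Omega : measurableType d) (P : probability Omega R)
    (I : finType) (X : I -> {RV P >-> R}) : Prop :=
  forall (J : {set I}) (B : I -> set R), (forall i, measurable (B i)) ->
    P (\bigcap_(i in [set` J]) (X i @^-1` B i)) =
    (\prod_(i in J) P (X i @^-1` B i))%E.

Definition uniformly_distributed (R : realType) (d : measure_display)
    (Omega : measurableType d) (P : probability Omega R)
    (X : {RV P >-> R}) (p q : R) : Prop :=
  exists pq : p < q, forall B : set R, measurable B ->
    distribution P X B = uniform_prob pq B.

Definition has_density (R : realType) (d : measure_display)
    (Omega : measurableType d) (P : probability Omega R)
    (X : Omega -> R) (f : R -> R) : Prop :=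
  [/\ measurable_fun setT X, measurable_fun setT f, forall x, 0 <= f x &
      forall B : set R, measurable B ->
        P (X @^-1` B) = (\int[lebesgue_measure]_(x in B) (f x)%:E)%E].

(* Extended-real valued, so that no finiteness of the integral is built in. *)
Definition convolution (R : realType) (f g : R -> \bar R) (y : R) : \bar R :=
  (\int[lebesgue_measure]_s (f s * g (y - s)%R))%E.

(* If the g k are densities of three independent variables, this is the density
   of one third of their sum. *)
Definition mean_density (R : realType) (g : 'I_3 -> R -> R) (u : R) : \bar R :=
  (3%:E * convolution
            (convolution (EFin \o g 0%R) (EFin \o g 1%R)) (EFin \o g 2%R)
            (3 * u)%R)%E.

(* The parameter a(t) of the grey wolf optimizer, with tmax iterations. *)
Definition gwo_a (R : realType) (t tmax : nat) : R :=
  2 * (1 - t%:R / tmax%:R).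

Definition gwo_summand (R : realType) (Omega : Type) (p x : R)
    (A C : Omega -> R) (w : Omega) : R :=
  p + A w * `|C w * p - x|.

Definition gwo_update (R : realType) (Omega : Type) (p : 'I_3 -> R) (x : R)
    (A C : 'I_3 -> Omega -> R) (w : Omega) : R :=
  3^-1 * (\sum_(k < 3) p k) + 3^-1 * (\sum_(k < 3) A k w * `|C k w * p k - x|).

Definition gwo_radius (R : realType) (a p x : R) : R :=
  a * (`|p| + `|x - p|).

(* Main.v *)
Require Import Defs.
From HB Require Import structures.
From mathcomp Require Import all_boot all_order all_algebra.
From mathcomp Require Import ring lra.
From mathcomp Require Import all_classical all_reals all_analysis measurable_realfun.
Import Order.TTheory GRing.Theory Num.Theory numFieldNormedType.Exports.

Set Implicit Arguments.
Unset Strict Implicit.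
Unset Printing Implicit Defensive.

Local Open Scope classical_set_scope.
Local Open Scope ring_scope.

(** Given [C = c], the summand [p + A * `|C * p - x|] is uniform on the interval
of centre [p] and half-width [rho c = a * `|c * p - x|].  Its density is
therefore the mixture [gwo_edensity] of uniform densities over [c] uniform on
[0, 2] ([gwo_summand_edensity]).  This density may have a logarithmic
singularity at [p], so it need not be bounded; everything rests on the fact
that [rho c ^ (- 1 / 2)] has a finite mean ([mean_rsqrt_lty]).

Boundedness.  The convolution of uniform densities of half-widths [r] and [r']
is at most [1 / (2 * max r r')], which is at most
[(1 / 2) * r ^ (- 1 / 2) * r' ^ (- 1 / 2)].  Averaging over the two
parameters shows that the convolution [G] of two summand densities is bounded
by some [K] ([convolution_gwo_bound]).

Continuity.  The convolution of [G] with a uniform density of half-width [r] is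
bounded by [K] and is Lipschitz with constant [K / (2 * r)], so its variation
between [v] and [v'] is at most [K * sqrt (`|v - v'| / r)].  Averaging over the
third parameter gives a function that is Hölder continuous of exponent [1 / 2]
([convolution_gwo_holder]).

Support.  A summand density is positive on the open interval of centre [p] and
radius [gwo_radius a p x], and zero outside the closed one
([gwo_edensity_support]).  A convolution of two such functions is positive
exactly on the open interval whose centre and radius are the sums of the given
ones ([convolution_gt0], [convolution_eq0]); at the endpoints the two carriers
meet in a null set.

Probability.  Mutual independence is assumed for the six parameters; a monotone
class argument, one pair [(C k, A k)] at a time, yields the independence of the
three summands ([indep_pairs]), and the law of a sum of independent variables
has the convolution as a density ([sum_edensity]).  Since convolutions do not
see null sets, the explicit densities may replace any given versions
([convolution_ae_eq]). *)

Local Notation mu := lebesgue_measure.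

(** * Affine changes of variables and Tonelli's theorem on the line *)

Lemma lebesgue_measure_affine_ocitv (R : realType) (r q a b : R) : r != 0 -> a < b ->
  @lebesgue_measure R ((fun z => r * z + q) @^-1` `]a, b]) = ((b - a) / `|r|)%:E.
Proof.
move=> r0 ab; have [r_gt0|r_lt0|r00] := ltrgtP 0 r; last by rewrite -r00 eqxx in r0.
- have -> : (fun z => r * z + q) @^-1` `]a, b] = `](a - q) / r, (b - q) / r]%classic.
    apply/seteqP; split => z /=; rewrite !in_itv/= ltr_pdivrMr// ler_pdivlMr// (mulrC z).
      by rewrite ltrBlDr lerBrDr.
    by rewrite ltrBlDr lerBrDr.
  rewrite lebesgue_measure_itv/= lte_fin ltr_pM2r ?invr_gt0// ltrD2r ab.
  by rewrite -EFinD -mulrBl gtr0_norm//; congr (_ / _)%:E; ring.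
- have -> : (fun z => r * z + q) @^-1` `]a, b] = `[(b - q) / r, (a - q) / r[%classic.
    apply/seteqP; split => z /=; rewrite !in_itv/= ltr_ndivlMr// ler_ndivrMr// (mulrC z).
      by rewrite ltrBlDr lerBrDr andbC.
    by rewrite ltrBlDr lerBrDr andbC.
  rewrite lebesgue_measure_itv/= lte_fin ltr_nM2r ?invr_lt0// ltrD2r ab.
  by rewrite -EFinD -mulrBl ltr0_norm// invrN mulrN -mulNr; congr (_ / _)%:E; ring.
Qed.

Lemma measurable_affine (R : realType) (r q : R) :
  measurable_fun setT (fun z : R => r * z + q).
Proof. by apply: measurable_funD => //; exact: measurable_funM. Qed.

(** Both sides are measures in [A], and Lebesgue measure is determined by its
values on the intervals [`]a, b]]. *)
Lemma lebesgue_measure_affine (R : realType) (r q : R) (A : set R) : r != 0 ->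
  measurable A ->
  @lebesgue_measure R A =
  (`|r|%:E * @lebesgue_measure R ((fun z => (r * z + q)%R) @^-1` A))%E.
Proof.
move=> r0 mA.
pose f : R -> R := fun z => r * z + q.
have rn : (0 <= `|r|) by [].
pose m0 : {measure set (measurableTypeR R) -> \bar R} :=
  pushforward (@lebesgue_measure R) (f : _ -> measurableTypeR R).
pose m : {measure set (measurableTypeR R) -> \bar R} :=
  mscale (NngNum rn) (m0 (measurable_affine r q)).
rewrite (@lebesgue_measure_unique R m)// => _ [[a b]/= _ <-].
rewrite /m/= /mscale/= /pushforward/=.
have [ab|ba] := ltP a b; last first.
  by rewrite !set_itv_ge ?bnd_simp -?leNgt// preimage_set0 !measure0 mule0.
rewrite lebesgue_measure_affine_ocitv// lebesgue_measure_itv/= lte_fin ab.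
by rewrite -EFinD -EFinM mulrCA divff ?mulr1// normr_eq0.
Qed.

Lemma ge0_integral_affine (R : realType) (r q : R) (f : R -> \bar R) : r != 0 ->
  measurable_fun setT f -> (forall z, 0 <= f z)%E ->
  (\int[@lebesgue_measure R]_z f z =
   `|r|%:E * \int[@lebesgue_measure R]_z f (r * z + q)%R)%E.
Proof.
move=> r0 mf f0.
have rn : (0 <= `|r|) by [].
pose f' : R -> R := fun z => r * z + q.
pose m0 : {measure set (measurableTypeR R) -> \bar R} :=
  pushforward (@lebesgue_measure R) (f' : _ -> measurableTypeR R).
pose m := m0 (measurable_affine r q).
rewrite (@eq_measure_integral _ _ _ _ (mscale (NngNum rn) m)).
  by rewrite ge0_integral_mscale//= /m /m0 ge0_integral_pushforward//; exact: measurable_affine.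
move=> A mA _; exact: (@lebesgue_measure_affine R r q).
Qed.

Lemma affine_negligible (R : realType) (r q : R) (N : set R) : r != 0 ->
  mu.-negligible N -> mu.-negligible ((fun z => r * z + q) @^-1` N).
Proof.
move=> r0 [A [mA A0 NA]]; exists ((fun z => r * z + q) @^-1` A); split.
- by rewrite -[X in measurable X]setTI; exact: measurable_affine.
- apply/eqP; have := A0; rewrite (lebesgue_measure_affine q r0 mA) => /eqP.
  by rewrite mule_eq0 eqe normr_eq0 (negbTE r0).
- by move=> z /NA.
Qed.

Lemma lebesgue_tonelli (R : realType) (f : R * R -> \bar R) :
  measurable_fun setT f -> (forall z, 0 <= f z)%E ->
  (\int[mu]_x \int[mu]_y f (x, y) = \int[mu]_y \int[mu]_x f (x, y))%E.
Proof.
move=> mf f0.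
exact: (@fubini_tonelli _ _ (measurableTypeR R) (measurableTypeR R) R mu mu f mf f0).
Qed.

Lemma measurable_lebesgue_integral (R : realType) (f : R * R -> \bar R) :
  measurable_fun setT f -> (forall z, 0 <= f z)%E ->
  measurable_fun setT (fun x => \int[mu]_y f (x, y))%E.
Proof.
move=> mf f0.
have := @measurable_fun_fubini_tonelli_F _ _ (measurableTypeR R) (measurableTypeR R) R mu f mf f0.
exact.
Qed.

(** * Convolution *)

Lemma measurable_convolution (R : realType) (f g : R -> \bar R) :
  measurable_fun setT f -> measurable_fun setT g ->
  (forall z, 0 <= f z)%E -> (forall z, 0 <= g z)%E ->
  measurable_fun setT (convolution f g).
Proof.
move=> mf mg f0 g0.
apply: (@measurable_lebesgue_integral R
  (fun ys : R * R => f ys.2 * g (ys.1 - ys.2)%R)%E).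
  apply: emeasurable_funM; first exact: measurableT_comp.
  by apply: measurableT_comp => //; exact: measurable_funB.
by move=> ys; exact: mule_ge0.
Qed.

Lemma convolution_ge0 (R : realType) (f g : R -> \bar R) y :
  (forall z, 0 <= f z)%E -> (forall z, 0 <= g z)%E -> (0 <= convolution f g y)%E.
Proof. by move=> f0 g0; apply: integral_ge0 => s _; exact: mule_ge0. Qed.

Lemma measurable_shifted (R : realType) (y : R) (g : R -> \bar R) :
  measurable_fun setT g -> measurable_fun setT (fun s : R => g (y - s)).
Proof. by move=> mg; apply: measurableT_comp => //; exact: measurable_funB. Qed.

Lemma convolutionC (R : realType) (f g : R -> \bar R) y :
  measurable_fun setT f -> measurable_fun setT g ->
  (forall z, 0 <= f z)%E -> (forall z, 0 <= g z)%E ->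
  convolution f g y = convolution g f y.
Proof.
move=> mf mg f0 g0.
rewrite /convolution (@ge0_integral_affine _ (-1) y)//.
- rewrite normrN1 mul1e; apply: eq_integral => s _.
  by rewrite mulN1r (addrC _ y) subKr muleC.
- by apply: emeasurable_funM => //; exact: measurable_shifted.
- by move=> s; exact: mule_ge0.
Qed.

(** A convolution is an integral, so it is the same function, at every point,
for all versions of the two densities.  This is what makes the pointwise
conclusions of the theorem independent of the choice of versions. *)
Lemma convolution_ae_eq (R : realType) (f f' g g' : R -> \bar R) :
  measurable_fun setT f -> measurable_fun setT g ->
  measurable_fun setT f' -> measurable_fun setT g' ->
  ae_eq mu setT f f' -> ae_eq mu setT g g' ->
  convolution f g = convolution f' g'.
Proof.
move=> mf mg mf' mg' ff' gg'; apply/funext => y.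
apply: ae_eq_integral => //.
- by apply: emeasurable_funM => //; exact: measurable_shifted.
- by apply: emeasurable_funM => //; exact: measurable_shifted.
have h : {ae mu, forall s, g (y - s) = g' (y - s)}.
  have := @affine_negligible R (-1) y _ _ gg'.
  rewrite oppr_eq0 oner_eq0 => /(_ isT); apply: negligibleS => s /= gs /(_ I).
  by rewrite mulN1r addrC.
move: ff' h; apply: filterS2 => s /(_ I) -> -> //.
Qed.

(** * Joint laws and densities *)

Definition rv_pair (R : realType) (d : measure_display) (Omega : measurableType d)
  (U V : Omega -> R) (w : Omega) : R * R := (U w, V w).

Lemma measurable_rv_pair (R : realType) (d : measure_display) (Omega : measurableType d)
  (U V : Omega -> R) :
  measurable_fun setT U -> measurable_fun setT V -> measurable_fun setT (rv_pair U V).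
Proof. by move=> mU mV; exact: measurable_fun_pair. Qed.

(** The event [E] stands for whatever else is independent of the pair: keeping it
on both sides lets the product rule be extended from rectangles to measurable
sets for one pair of variables at a time. *)
Lemma product_law (R : realType) (d : measure_display)
    (Omega : measurableType d) (P : probability Omega R) (U V : {RV P >-> R})
    (E : set Omega) : measurable E ->
  (forall B1 B2 : set R, measurable B1 -> measurable B2 ->
    P ((U @^-1` B1 `&` V @^-1` B2) `&` E) = P (U @^-1` B1) * P (V @^-1` B2) * P E)%E ->
  forall D : set (R * R), measurable D ->
    (P (rv_pair U V @^-1` D `&` E) =
     (distribution P U \x distribution P V) D * P E)%E.
Proof.
move=> mE indep D mD.
have mUV : measurable_fun setT (rv_pair U V) by apply: measurable_rv_pair; exact: measurable_funP.
have mUVD : measurable (rv_pair U V @^-1` D) by rewrite -[X in measurable X]setTI; exact: mUV.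
have [PE0|PE0] := eqVneq (P E) 0.
  rewrite PE0 mule0; apply/eqP; rewrite -measure_le0 -PE0; apply: le_measure; rewrite ?inE//.
  exact: measurableI.
(* product measures are characterised through a measure with the right values
   on rectangles, so the law restricted to E is normalised by P E *)
pose e := fine (P E).
have eE : P E = e%:E by rewrite fineK// fin_num_measure.
have e0 : e != 0 by move: PE0; rewrite eE eqe.
have ei : 0 <= e^-1 by rewrite invr_ge0 fine_ge0.
pose m0 : {measure set (R * R) -> \bar R} := pushforward (mrestr P mE) (rv_pair U V).
pose m := mscale (NngNum ei) (m0 mUV).
have /(_ m) -> // := @product_measure_unique _ _ _ _ _ (distribution P U) (distribution P V).
  rewrite /m /m0 /mscale /pushforward /mrestr /= -/e.
  rewrite muleC muleA eE -EFinM divff// mul1e.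
  reflexivity.
move=> A B mA mB.
rewrite /m /mscale/= /pushforward/= /mrestr.
transitivity (e^-1%:E * (P ((U @^-1` A `&` V @^-1` B) `&` E)))%E; first by [].
rewrite indep//.
by rewrite /= eE muleCA -EFinM mulVf// mule1.
Qed.

Lemma product_lawT (R : realType) (d : measure_display)
    (Omega : measurableType d) (P : probability Omega R) (U V : {RV P >-> R}) :
  (forall B1 B2 : set R, measurable B1 -> measurable B2 ->
    P (U @^-1` B1 `&` V @^-1` B2) = P (U @^-1` B1) * P (V @^-1` B2))%E ->
  forall D : set (R * R), measurable D ->
    (P (rv_pair U V @^-1` D) = (distribution P U \x distribution P V) D)%E.
Proof.
move=> indep D mD.
have := @product_law R d Omega P U V setT measurableT _ D mD.
rewrite setIT probability_setT mule1; apply => B1 B2 mB1 mB2.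
by rewrite setIT mule1 indep.
Qed.

(** The explicit densities below are integrals that may be infinite at isolated
points, hence the values in [\bar R]. *)
Definition has_edensity (R : realType) (d : measure_display)
    (Omega : measurableType d) (P : probability Omega R)
    (X : Omega -> R) (f : R -> \bar R) : Prop :=
  [/\ measurable_fun setT X, measurable_fun setT f, forall z, (0 <= f z)%E &
      forall B : set R, measurable B -> P (X @^-1` B) = (\int[mu]_(z in B) f z)%E].

Lemma has_density_edensity (R : realType) (d : measure_display)
    (Omega : measurableType d) (P : probability Omega R) (X : Omega -> R) (f : R -> R) :
  has_density P X f <-> has_edensity P X (EFin \o f).
Proof.
split=> -[mX mf f0 h]; split => //.
  exact/measurable_EFinP.
exact/measurable_EFinP.
Qed.

Lemma integral_edensity (R : realType) (d : measure_display)
    (Omega : measurableType d) (P : probability Omega R) (X : Omega -> R) (f : R -> \bar R) :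
  has_edensity P X f -> (\int[mu]_z f z = 1)%E.
Proof.
by move=> [mX mf f0 h]; rewrite -(h _ measurableT) preimage_setT probability_setT.
Qed.

Lemma edensity_integrable (R : realType) (d : measure_display)
    (Omega : measurableType d) (P : probability Omega R) (X : Omega -> R) (f : R -> \bar R) :
  has_edensity P X f -> mu.-integrable setT f.
Proof.
move=> hf; have [mX mf f0 h] := hf; apply/integrableP; split => //.
under eq_integral do rewrite gee0_abs//.
by rewrite (integral_edensity hf) ltry.
Qed.

Lemma edensity_ae_unique (R : realType) (d : measure_display)
    (Omega : measurableType d) (P : probability Omega R) (X : Omega -> R)
    (f g : R -> \bar R) :
  has_edensity P X f -> has_edensity P X g -> ae_eq mu setT f g.
Proof.
move=> hf hg; apply: integral_ae_eq => //.
- exact: edensity_integrable hf.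
- by case: hg.
- by move=> E _ mE; case: hf => _ _ _ <- //; case: hg => _ _ _ <-.
Qed.

(** By uniqueness, the density is the Radon-Nikodym derivative of the law. *)
Lemma ge0_integral_edensity (R : realType) (d : measure_display)
    (Omega : measurableType d) (P : probability Omega R) (X : {RV P >-> R})
    (f F : R -> \bar R) :
  has_edensity P X f -> measurable_fun setT F -> (forall z, 0 <= F z)%E ->
  (\int[distribution P X]_z F z = \int[mu]_z (F z * f z))%E.
Proof.
move=> hf mF F0; have [mX mf f0 h] := hf.
pose X' : {mfun Omega >-> measurableTypeR R} :=
  HB.pack (X : Omega -> measurableTypeR R)
    (@isMeasurableFun.Build _ _ Omega (measurableTypeR R) X mX).
pose nu : {finite_measure set (measurableTypeR R) -> \bar R} := distribution P X'.
have numu : nu `<< mu.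
  apply/null_content_dominatesP => A mA A0; rewrite /nu/= /distribution /pushforward h//.
  apply: null_set_integral => //; exact: measurable_funTS.
transitivity (\int[mu]_z (F z * Radon_Nikodym_SigmaFinite.f nu mu z))%E.
  rewrite (Radon_Nikodym_SigmaFinite.change_of_variables numu)//.
  by rewrite !ge0_integral_distribution.
have RNi := Radon_Nikodym_SigmaFinite.f_integrable numu.
apply: ae_eq_integral => //.
- by apply: emeasurable_funM => //; exact: measurable_int RNi.
- exact: emeasurable_funM.
- apply: ae_eqe_mul2l; apply: integral_ae_eq => // A _ mA.
  by rewrite -Radon_Nikodym_SigmaFinite.f_integral// -h.
Qed.

Lemma integral_indicE (R : realType) (D : set R) (f : R -> \bar R) : measurable D ->
  measurable_fun setT f ->
  (\int[mu]_(z in D) f z = \int[mu]_z ((\1_D z)%:E * f z))%E.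
Proof.
move=> mD mf; rewrite integral_mkcond; apply: eq_integral => z _.
by rewrite patchE indicE; case: ifPn; rewrite ?mul1e ?mul0e.
Qed.

Lemma preimage_measurable (d1 d2 : measure_display) (T1 : measurableType d1)
  (T2 : measurableType d2) (f : T1 -> T2) (B : set T2) :
  measurable_fun setT f -> measurable B -> measurable (f @^-1` B).
Proof. by move=> mf mB; rewrite -[X in measurable X]setTI; exact: mf. Qed.

(** The law of the sum is the image of the product law; the shift [z = u + v] in
the inner integral and Tonelli's theorem turn it into the convolution. *)
Lemma sum_edensity (R : realType) (d : measure_display)
    (Omega : measurableType d) (P : probability Omega R) (U V : {RV P >-> R})
    (f g : R -> \bar R) :
  (forall B1 B2 : set R, measurable B1 -> measurable B2 ->
    P (U @^-1` B1 `&` V @^-1` B2) = P (U @^-1` B1) * P (V @^-1` B2))%E ->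
  has_edensity P U f -> has_edensity P V g ->
  has_edensity P (U \+ V) (convolution f g).
Proof.
move=> indep hU hV; have [mU mf f0 fE] := hU; have [mV mg g0 gE] := hV.
split; [exact: measurable_funD | exact: measurable_convolution
       | by move=> z; exact: convolution_ge0 |].
move=> B mB.
pose D : set (R * R) := (fun uv => uv.1 + uv.2) @^-1` B.
have mD : measurable D by apply: preimage_measurable => //; exact: measurable_funD.
transitivity (P (rv_pair U V @^-1` D)); first by [].
rewrite (product_lawT indep)//.
rewrite /product_measure1 (ge0_integral_edensity hU)//; last exact: measurable_fun_xsection.
pose h (uz : R * R) : \bar R := ((\1_B uz.2)%:E * (f uz.1 * g (uz.2 - uz.1)%R))%E.
have h0 uz : (0 <= h uz)%E by rewrite /h !mule_ge0// lee_fin.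
have mh : measurable_fun setT h.
  apply: emeasurable_funM.
    by apply/measurable_EFinP; apply: measurableT_comp => //; exact: measurable_indic.
  apply: emeasurable_funM; first exact: measurableT_comp.
  by apply: measurableT_comp => //; exact: measurable_funB.
transitivity (\int[mu]_u \int[mu]_z h (u, z))%E.
  apply: eq_integral => u _.
  rewrite /= /distribution /pushforward gE; last exact: measurable_xsection.
  rewrite integral_indicE//; last exact: measurable_xsection.
  rewrite (@ge0_integral_affine _ 1 (- u))//; last 2 first.
    apply: emeasurable_funM => //; apply/measurable_EFinP/measurable_indic.
    exact: measurable_xsection.
    by move=> z; rewrite mule_ge0// lee_fin.
  rewrite normr1 mul1e muleC -ge0_integralZl//; last 2 first.
  - apply: emeasurable_funM.
      apply/measurable_EFinP; apply: measurableT_comp; last exact: measurable_affine.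
      by apply: measurable_indic; exact: measurable_xsection.
    by apply: measurableT_comp => //; exact: measurable_affine.
  - by move=> z _; rewrite mule_ge0// lee_fin.
  apply: eq_integral => z _; rewrite /h/= muleCA mul1r; congr (_%:E * _)%E.
  rewrite !indicE mem_xsection; congr (nat_of_bool _)%:R.
  by apply/idP/idP; rewrite !inE /D/= addrC subrK.
rewrite (lebesgue_tonelli mh h0) [RHS]integral_indicE//; last exact: measurable_convolution.
apply: eq_integral => z _; rewrite /h/= ge0_integralZl//.
- by apply: emeasurable_funM => //; exact: measurable_shifted.
- by move=> s _; exact: mule_ge0.
Qed.

(** * Uniform densities and their mixtures *)

Lemma uniform_pdf_nneg (R : realType) (l r z : R) : 0 <= uniform_pdf l r z.
Proof.
rewrite /uniform_pdf; case: ifPn => // /andP[lz zr].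
by rewrite invr_ge0 subr_ge0 (le_trans lz).
Qed.

(** The inverse is written as a power of an absolute value because the power
function is measurable on the whole line. *)
Lemma measurable_uniform_pdf_param (d : measure_display) (T : measurableType d)
    (R : realType) (l r z : T -> R) :
  measurable_fun setT l -> measurable_fun setT r -> measurable_fun setT z ->
  measurable_fun setT (fun t => uniform_pdf (l t) (r t) (z t)).
Proof.
move=> ml mr mz.
rewrite (_ : (fun t => _) =
  (fun t => if l t <= z t <= r t then `|r t - l t| `^ (-1) else 0)); last first.
  apply/funext => t; rewrite /uniform_pdf; case: ifPn => // /andP[lz zr].
  by rewrite powR_inv1// ger0_norm// subr_ge0 (le_trans lz).
apply: measurable_fun_ifT => //.
  by apply: measurable_and; exact: measurable_fun_ler.
apply: (measurableT_comp (measurable_powR (-1))).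
by apply: measurableT_comp => //; exact: measurable_funB.
Qed.

Definition unif_around (R : realType) (p rho : R) : R -> \bar R :=
  fun z => (uniform_pdf (p - rho) (p + rho) z)%:E.

Lemma unif_around_ge0 (R : realType) (p rho z : R) : (0 <= unif_around p rho z)%E.
Proof. by rewrite lee_fin uniform_pdf_nneg. Qed.

Lemma measurable_unif_around (R : realType) (p rho : R) :
  measurable_fun setT (unif_around p rho).
Proof. by apply/measurable_EFinP; exact: measurable_uniform_pdf. Qed.

(** The density of a variable whose conditional density is [k c] when a parameter
of density [w] takes the value [c]. *)
Definition mixture (R : realType) (w : R -> \bar R) (k : R -> R -> \bar R) (z : R) : \bar R :=
  (\int[mu]_c (w c * k c z))%E.

Lemma mixture_ge0 (R : realType) (w : R -> \bar R) (k : R -> R -> \bar R) z :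
  (forall c, 0 <= w c)%E -> (forall c z, 0 <= k c z)%E -> (0 <= mixture w k z)%E.
Proof. by move=> w0 k0; apply: integral_ge0 => c _; exact: mule_ge0. Qed.

Lemma measurable_mixture (R : realType) (w : R -> \bar R) (k : R -> R -> \bar R) :
  (forall c, 0 <= w c)%E -> (forall c z, 0 <= k c z)%E ->
  measurable_fun setT w -> measurable_fun setT (fun cz : R * R => k cz.1 cz.2) ->
  measurable_fun setT (mixture w k).
Proof.
move=> w0 k0 mw mk.
apply: (@measurable_lebesgue_integral R (fun zc => w zc.2 * k zc.2 zc.1)%E).
  apply: emeasurable_funM; first exact: measurableT_comp.
  rewrite (_ : (fun zc => _) =
    (fun cz => k cz.1 cz.2) \o (fun zc : R * R => (zc.2, zc.1)))//.
  by apply: measurableT_comp => //; exact: measurable_fun_pair.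
by move=> zc; exact: mule_ge0.
Qed.

Lemma measurable_kernel1 (R : realType) (k : R -> R -> \bar R) c :
  measurable_fun setT (fun cz : R * R => k cz.1 cz.2) -> measurable_fun setT (k c).
Proof. move=> mk; rewrite (_ : k c = (fun cz => k cz.1 cz.2) \o pair c)//.
by apply: measurableT_comp => //; exact: pair1_measurable. Qed.

Lemma measurable_kernel2 (R : realType) (k : R -> R -> \bar R) z :
  measurable_fun setT (fun cz : R * R => k cz.1 cz.2) -> measurable_fun setT (k ^~ z).
Proof. move=> mk; rewrite (_ : k ^~ z = (fun cz => k cz.1 cz.2) \o pair^~ z)//.
by apply: measurableT_comp => //; exact: pair2_measurable. Qed.

Lemma integral_mixture (R : realType) (w : R -> \bar R) (k : R -> R -> \bar R)
    (F : R -> \bar R) :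
  (forall c, 0 <= w c)%E -> (forall c z, 0 <= k c z)%E -> (forall z, 0 <= F z)%E ->
  measurable_fun setT w -> measurable_fun setT (fun cz : R * R => k cz.1 cz.2) ->
  measurable_fun setT F ->
  (\int[mu]_z (mixture w k z * F z) = \int[mu]_c (w c * \int[mu]_z (k c z * F z)))%E.
Proof.
move=> w0 k0 F0 mw mk mF.
pose h (cz : R * R) : \bar R := (w cz.1 * (k cz.1 cz.2 * F cz.2))%E.
have h0 cz : (0 <= h cz)%E by rewrite /h !mule_ge0.
have mh : measurable_fun setT h.
  apply: emeasurable_funM; first exact: measurableT_comp.
  by apply: emeasurable_funM => //; exact: measurableT_comp.
transitivity (\int[mu]_z \int[mu]_c h (c, z))%E.
  apply: eq_integral => z _; rewrite muleC /mixture -ge0_integralZl//.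
  - by apply: eq_integral => c _; rewrite /h/= muleC -muleA.
  - by apply: emeasurable_funM => //; exact: measurable_kernel2.
  - by move=> c _; exact: mule_ge0.
rewrite -lebesgue_tonelli//; apply: eq_integral => c _; rewrite /h/= ge0_integralZl//.
- by apply: emeasurable_funM => //; exact: measurable_kernel1.
- by move=> z _; exact: mule_ge0.
Qed.

Lemma convolution_mixture (R : realType) (w : R -> \bar R) (k : R -> R -> \bar R)
    (F : R -> \bar R) y :
  (forall c, 0 <= w c)%E -> (forall c z, 0 <= k c z)%E -> (forall z, 0 <= F z)%E ->
  measurable_fun setT w -> measurable_fun setT (fun cz : R * R => k cz.1 cz.2) ->
  measurable_fun setT F ->
  convolution (mixture w k) F y = (\int[mu]_c (w c * convolution (k c) F y))%E.
Proof.
move=> w0 k0 F0 mw mk mF; rewrite /convolution.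
by apply: (@integral_mixture R w k (fun s => F (y - s))) => //; exact: measurable_shifted.
Qed.

(** * The density of one summand *)

(** Given [C = c], the summand [p + A * `|c * p - x|] is uniform on the interval
of centre [p] and this half-width. *)
Definition half_width (R : realType) (a p x c : R) : R := a * `|c * p - x|.

Definition gwo_kernel (R : realType) (a p x c z : R) : \bar R :=
  unif_around p (half_width a p x c) z.

Definition gwo_edensity (R : realType) (a p x : R) : R -> \bar R :=
  mixture (EFin \o uniform_pdf 0 2) (gwo_kernel a p x).

Lemma half_width_ge0 (R : realType) (a p x c : R) : 0 <= a -> 0 <= half_width a p x c.
Proof. by move=> a0; rewrite mulr_ge0. Qed.

Lemma measurable_half_width (R : realType) (a p x : R) :
  measurable_fun setT (half_width a p x).
Proof.
apply: measurable_funM => //; apply: measurableT_comp => //.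
by apply: measurable_funB => //; exact: measurable_funM.
Qed.

Lemma measurable_gwo_kernel (R : realType) (a p x : R) :
  measurable_fun setT (fun cz : R * R => gwo_kernel a p x cz.1 cz.2).
Proof.
apply/measurable_EFinP; apply: measurable_uniform_pdf_param => //.
- apply: measurable_funB => //; apply: measurableT_comp => //.
  exact: measurable_half_width.
- apply: measurable_funD => //; apply: measurableT_comp => //.
  exact: measurable_half_width.
Qed.

Lemma measurable_gwo_edensity (R : realType) (a p x : R) :
  measurable_fun setT (gwo_edensity a p x).
Proof.
apply: measurable_mixture.
- by move=> c; rewrite lee_fin uniform_pdf_nneg.
- by move=> c z; exact: unif_around_ge0.
- by apply/measurable_EFinP; exact: measurable_uniform_pdf.
- exact: measurable_gwo_kernel.
Qed.

Lemma gwo_edensity_ge0 (R : realType) (a p x z : R) : (0 <= gwo_edensity a p x z)%E.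
Proof.
by apply: mixture_ge0 => [c|c z']; rewrite ?lee_fin ?uniform_pdf_nneg// unif_around_ge0.
Qed.

(** The half-width vanishes only at [c = x / p] when [p <> 0], and nowhere when
[p = 0] because then [x <> 0]. *)
Lemma half_width_neq0_ae (R : realType) (a p x : R) : 0 < a -> 0 < `|p| + `|x - p| ->
  {ae mu, forall c, 0 < half_width a p x c}.
Proof.
move=> a0 px0.
have [p0|p0] := eqVneq p 0.
  apply: aeW => c; rewrite /half_width p0 mulr0 sub0r normrN mulr_gt0//.
  by move: px0; rewrite p0 normr0 add0r subr0.
exists [set x / p]; split => //; first by rewrite lebesgue_measure_set1.
move=> c /= /negP; rewrite -leNgt => h.
have : half_width a p x c == 0 by rewrite eq_le h half_width_ge0// ltW.
rewrite mulf_eq0 gt_eqF//= normr_eq0 subr_eq0 => /eqP <-.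
by rewrite mulfK.
Qed.

Lemma uniform_pdf_affine (R : realType) (a p r s : R) : 0 < r ->
  uniform_pdf (p - a * r) (p + a * r) (r * s + p) = r^-1 * uniform_pdf (- a) a s.
Proof.
move=> r0; rewrite /uniform_pdf.
have -> : (p - a * r <= r * s + p <= p + a * r) = (- a <= s <= a).
  rewrite (addrC (r * s)) !lerD2l -mulNr (mulrC r).
  by rewrite !ler_pM2r.
case: ifPn => _; last by rewrite mulr0.
rewrite -invfM; congr (_^-1); ring.
Qed.

(** Condition on [C]: for almost every [c] the half-width is positive and the
substitution [z = `|c * p - x| * s + p] carries the uniform density of [A] to
[gwo_kernel a p x c]; Tonelli's theorem exchanges the integrals in [c] and
[z]. *)
Lemma gwo_summand_edensity (R : realType) (d : measure_display)
    (Omega : measurableType d) (P : probability Omega R) (a p x : R)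
    (A C : {RV P >-> R}) :
  0 < a -> 0 < `|p| + `|x - p| ->
  has_edensity P A (EFin \o uniform_pdf (- a) a) ->
  has_edensity P C (EFin \o uniform_pdf 0 2) ->
  (forall B1 B2 : set R, measurable B1 -> measurable B2 ->
    P (C @^-1` B1 `&` A @^-1` B2) = P (C @^-1` B1) * P (A @^-1` B2))%E ->
  has_edensity P (gwo_summand p x A C) (gwo_edensity a p x).
Proof.
move=> a0 px0 hA hC indep.
have [mA _ _ AE] := hA; have [mC mw w0 CE] := hC.
have mS : measurable_fun setT (fun ca : R * R => p + ca.2 * `|ca.1 * p - x|).
  apply: measurable_funD => //; apply: measurable_funM => //.
  apply: measurableT_comp => //; apply: measurable_funB => //.
  exact: measurable_funM.
split.
- rewrite (_ : gwo_summand p x A C =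
    (fun ca => p + ca.2 * `|ca.1 * p - x|) \o rv_pair C A)//.
  by apply: measurableT_comp => //; exact: measurable_rv_pair.
- exact: measurable_gwo_edensity.
- exact: gwo_edensity_ge0.
move=> B mB.
pose D : set (R * R) := (fun ca => p + ca.2 * `|ca.1 * p - x|) @^-1` B.
have mD : measurable D by exact: preimage_measurable.
transitivity (P (rv_pair C A @^-1` D)); first by [].
rewrite (product_lawT indep)//.
rewrite /product_measure1 (ge0_integral_edensity hC)//; last exact: measurable_fun_xsection.
rewrite [RHS]integral_indicE//; last exact: measurable_gwo_edensity.
under [RHS]eq_integral do rewrite muleC.
have mI : measurable_fun setT (fun z : R => (\1_B z)%:E : \bar R).
  by apply/measurable_EFinP; exact: measurable_indic.
rewrite integral_mixture//; last 2 first.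
- by move=> c z; exact: unif_around_ge0.
- exact: measurable_gwo_kernel.
apply: ge0_ae_eq_integral => //.
- apply: emeasurable_funM => //; exact: measurable_fun_xsection.
- apply: emeasurable_funM => //.
  apply: (@measurable_lebesgue_integral R (fun cz => gwo_kernel a p x cz.1 cz.2 * (\1_B cz.2)%:E)%E).
    by apply: emeasurable_funM; [exact: measurable_gwo_kernel|exact: (measurableT_comp mI)].
  by move=> cz; rewrite mule_ge0 ?lee_fin// uniform_pdf_nneg.
- by move=> c _; exact: mule_ge0.
- move=> c _; rewrite mule_ge0//; apply: integral_ge0 => z _.
  by rewrite mule_ge0 ?lee_fin// uniform_pdf_nneg.
apply: negligibleS (half_width_neq0_ae a0 px0) => c /= hc rc; apply: hc => _ {}.
have r0 : 0 < `|c * p - x| by move: rc; rewrite /half_width pmulr_rgt0.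
rewrite /= muleC; congr (_ * _)%E.
rewrite /distribution /pushforward AE; last exact: measurable_xsection.
rewrite (@ge0_integral_affine _ `|c * p - x| p) ?gt_eqF//; last 2 first.
- apply: emeasurable_funM => //; exact: measurable_kernel1 (measurable_gwo_kernel _ _ _).
- by move=> z; rewrite mule_ge0 ?lee_fin// uniform_pdf_nneg.
rewrite integral_indicE//; last 2 first.
- exact: measurable_xsection.
- by apply/measurable_EFinP; exact: measurable_uniform_pdf.
rewrite normr_id -ge0_integralZl//; last 2 first.
- apply: emeasurable_funM.
    apply: (measurableT_comp _ (measurable_affine _ _)).
    exact: measurable_kernel1 (measurable_gwo_kernel _ _ _).
  by apply: (measurableT_comp mI); exact: measurable_affine.
- by move=> z _; rewrite mule_ge0 ?lee_fin// uniform_pdf_nneg.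
apply: eq_integral => s _.
rewrite /gwo_kernel /unif_around /half_width uniform_pdf_affine// muleA muleC -!EFinM.
rewrite mulrA divff ?mul1r ?gt_eqF//; congr (_ * _)%:E.
rewrite !indicE mem_xsection; congr (nat_of_bool _)%:R.
by apply/idP/idP; rewrite !inE /D/= mulrC addrC.
Qed.

(** * Bounds for convolutions with uniform densities *)

(** For [rho = 0] the value at [p] is the inverse of [0], which is [0]. *)
Lemma unif_around_eq0 (R : realType) (p rho : R) : rho <= 0 ->
  unif_around p rho = cst 0%E.
Proof.
move=> rho0; apply/funext => z; rewrite /unif_around /uniform_pdf.
case: ifPn => // /andP[lz zr]; congr EFin; apply/eqP; rewrite invr_eq0; lra.
Qed.

Lemma integral_unif_around_le1 (R : realType) (p rho : R) :
  (\int[mu]_z unif_around p rho z <= 1)%E.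
Proof.
have [rho0|rho0] := leP rho 0.
  by rewrite unif_around_eq0// integral0.
rewrite integral_uniform_pdf1//; lra.
Qed.

Lemma unif_around_le (R : realType) (p rho z : R) : 0 <= rho ->
  (unif_around p rho z <= ((2 * rho)^-1)%:E)%E.
Proof.
move=> rho0; rewrite lee_fin /uniform_pdf; case: ifPn => _.
  by rewrite le_eqVlt; apply/orP; left; apply/eqP; congr (_^-1); ring.
by rewrite invr_ge0 mulr_ge0.
Qed.

Lemma convolution_le (R : realType) (f G : R -> \bar R) (K : R) y :
  measurable_fun setT f -> measurable_fun setT G ->
  (forall z, 0 <= f z)%E -> (forall z, 0 <= G z)%E -> (forall z, G z <= K%:E)%E ->
  (convolution f G y <= K%:E * \int[mu]_z f z)%E.
Proof.
move=> mf mG f0 G0 GK.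
have K0 : 0 <= K by rewrite -lee_fin (le_trans (G0 0)).
rewrite -ge0_integralZl// ?lee_fin//; apply: ge0_le_integral => //.
- by move=> s _; exact: mule_ge0.
- by apply: emeasurable_funM => //; exact: measurable_shifted.
- exact: emeasurable_funM.
- by move=> s _; rewrite muleC lee_wpmul2r.
Qed.

(** The convention [rsqrt 0 = 0] is harmless: a uniform density of half-width
[0] vanishes identically. *)
Definition rsqrt (R : realType) (rho : R) : R := rho `^ (- 2^-1).

Lemma rsqrtE (R : realType) (rho : R) : 0 <= rho -> rsqrt rho = (Num.sqrt rho)^-1.
Proof. by move=> rho0; rewrite /rsqrt powRN powR12_sqrt. Qed.

Lemma rsqrt_ge0 (R : realType) (rho : R) : 0 <= rsqrt rho.
Proof. exact: powR_ge0. Qed.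

(** With [r] and [s] the two half-widths, the bound [1 / (2 * max r s)] is
replaced by a product of a function of [r] and a function of [s], so that the
two parameters can be integrated separately. *)
Lemma half_inv_le (R : realType) (r s : R) : 0 < r -> r <= s ->
  (2 * s)^-1 <= 2^-1 * rsqrt r * rsqrt s.
Proof.
move=> r0 rs; have s0 : 0 < s by exact: lt_le_trans rs.
rewrite (rsqrtE (ltW r0)) (rsqrtE (ltW s0)) invfM -mulrA ler_pM2l// -invfM.
rewrite lef_pV2 ?posrE ?mulr_gt0 ?sqrtr_gt0//.
rewrite -{2}(sqr_sqrtr (ltW s0)) expr2 ler_pM2r ?sqrtr_gt0//.
by rewrite ler_sqrt// ltW.
Qed.

(** A convolution is bounded by the supremum of one factor times the integral of
the other; take the supremum of the wider, hence lower, uniform density. *)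
Lemma convolution_unif_le (R : realType) (p p' r r' y : R) : 0 <= r -> 0 <= r' ->
  (convolution (unif_around p r) (unif_around p' r') y <=
   (2^-1 * rsqrt r * rsqrt r')%:E)%E.
Proof.
wlog : p p' r r' / r <= r' => [hw|].
  move=> r0 r'0; have [rr'|/ltW r'r] := leP r r'; first exact: hw.
  rewrite convolutionC; try exact: measurable_unif_around; try by move=> z; exact: unif_around_ge0.
  by rewrite mulrAC; exact: hw.
move=> rr'; rewrite le_eqVlt => /predU1P[r0 _|r0 r'0].
  rewrite -r0 unif_around_eq0// /convolution integral0_eq ?lee_fin ?mulr_ge0 ?rsqrt_ge0//.
  by move=> s _; rewrite mul0e.
apply: (@le_trans _ _ (((2 * r')^-1)%:E * \int[mu]_z unif_around p r z))%E.
  apply: convolution_le; try exact: measurable_unif_around; try by move=> z; exact: unif_around_ge0.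
  by move=> z; exact: unif_around_le.
apply: (@le_trans _ _ ((2 * r')^-1)%:E).
  rewrite -[leRHS]mule1 lee_wpmul2l ?integral_unif_around_le1//.
  by rewrite lee_fin invr_ge0 mulr_ge0.
by rewrite lee_fin half_inv_le.
Qed.

Lemma measurable_rsqrt (R : realType) : measurable_fun setT (@rsqrt R).
Proof. exact: measurable_powR. Qed.

(** * Boundedness and Hölder continuity of convolutions with a summand density *)

(** The expectation of [rsqrt] of the half-width; the single integrability fact
behind both boundedness and continuity is that it is finite. *)
Definition mean_rsqrt (R : realType) (a p x : R) : \bar R :=
  (\int[mu]_c (uniform_pdf 0 2 c * rsqrt (half_width a p x c))%:E)%E.

Lemma mean_rsqrt_ge0 (R : realType) (a p x : R) : (0 <= mean_rsqrt a p x)%E.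
Proof.
by apply: integral_ge0 => c _; rewrite lee_fin mulr_ge0 ?uniform_pdf_nneg ?rsqrt_ge0.
Qed.

Lemma measurable_rsqrt_half_width (R : realType) (a p x : R) :
  measurable_fun setT (fun c => (rsqrt (half_width a p x c))%:E).
Proof.
apply/measurable_EFinP; apply: (measurableT_comp (@measurable_rsqrt R)).
exact: measurable_half_width.
Qed.

Lemma uniform02_ge0 (R : realType) (c : R) : (0 <= (EFin \o uniform_pdf 0 2) c)%E.
Proof. by rewrite lee_fin uniform_pdf_nneg. Qed.

Lemma measurable_uniform02 (R : realType) :
  measurable_fun setT (EFin \o @uniform_pdf R 0 2).
Proof. by apply/measurable_EFinP; exact: measurable_uniform_pdf. Qed.

Lemma measurable_weighted_rsqrt (R : realType) (a p x : R) :
  measurable_fun setT (fun c => (uniform_pdf 0 2 c * rsqrt (half_width a p x c))%:E).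
Proof.
by apply: eq_measurable_fun (emeasurable_funM (@measurable_uniform02 R)
  (measurable_rsqrt_half_width a p x)).
Qed.

Lemma gwo_kernel_ge0 (R : realType) (a p x c z : R) : (0 <= gwo_kernel a p x c z)%E.
Proof. exact: unif_around_ge0. Qed.

Lemma measurable_convolution_kernel (R : realType) (a p x : R) (F : R -> \bar R) y :
  measurable_fun setT F -> (forall z, 0 <= F z)%E ->
  measurable_fun setT (fun c => convolution (gwo_kernel a p x c) F y).
Proof.
move=> mF F0.
apply: (@measurable_lebesgue_integral R
  (fun cs => gwo_kernel a p x cs.1 cs.2 * F (y - cs.2)%R)%E).
  apply: emeasurable_funM; first exact: measurable_gwo_kernel.
  by apply: (measurableT_comp (measurable_shifted y mF)).
by move=> cs; rewrite mule_ge0 ?gwo_kernel_ge0.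
Qed.

Lemma convolution_gwo (R : realType) (a p x : R) (F : R -> \bar R) y :
  measurable_fun setT F -> (forall z, 0 <= F z)%E ->
  (convolution (gwo_edensity a p x) F y =
   \int[mu]_c ((uniform_pdf 0 2 c)%:E * convolution (gwo_kernel a p x c) F y))%E.
Proof.
move=> mF F0; apply: convolution_mixture => //.
- exact: uniform02_ge0.
- exact: gwo_kernel_ge0.
- exact: measurable_uniform02.
- exact: measurable_gwo_kernel.
Qed.

(** A comparison for each fixed [c] passes to the mixture.  With [F' = 0]
it gives bounds, with [F' = F] moduli of continuity. *)
Lemma convolution_gwo_compare (R : realType) (a p x : R) (F F' : R -> \bar R)
    (v v' : R) (B : \bar R) :
  measurable_fun setT F -> (forall z, 0 <= F z)%E ->
  measurable_fun setT F' -> (forall z, 0 <= F' z)%E -> (0 <= B)%E ->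
  (forall c, convolution (gwo_kernel a p x c) F v <=
    convolution (gwo_kernel a p x c) F' v' + B * (rsqrt (half_width a p x c))%:E)%E ->
  (convolution (gwo_edensity a p x) F v <=
   convolution (gwo_edensity a p x) F' v' + B * mean_rsqrt a p x)%E.
Proof.
move=> mF F0 mF' F'0 B0 h.
have m1 : measurable_fun setT (fun c =>
    (uniform_pdf 0 2 c)%:E * convolution (gwo_kernel a p x c) F v)%E.
  by apply: emeasurable_funM; [exact: measurable_uniform02|exact: measurable_convolution_kernel].
have m2 : measurable_fun setT (fun c =>
    (uniform_pdf 0 2 c)%:E * convolution (gwo_kernel a p x c) F' v')%E.
  by apply: emeasurable_funM; [exact: measurable_uniform02|exact: measurable_convolution_kernel].
have m3 := measurable_weighted_rsqrt a p x.
have k0 c F1 y : (forall z, 0 <= F1 z)%E -> (0 <= convolution (gwo_kernel a p x c) F1 y)%E.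
  by move=> F10; apply: convolution_ge0 => // z; exact: gwo_kernel_ge0.
have q0 c : 0 <= uniform_pdf 0 2 c * rsqrt (half_width a p x c).
  by rewrite mulr_ge0 ?uniform_pdf_nneg ?rsqrt_ge0.
rewrite !convolution_gwo// /mean_rsqrt -ge0_integralZl//; last by move=> c _; rewrite lee_fin.
rewrite -ge0_integralD//; last 3 first.
- by move=> c _; rewrite mule_ge0 ?k0// uniform02_ge0.
- by move=> c _; rewrite mule_ge0// lee_fin.
- exact: measurable_funeM.
apply: ge0_le_integral => //.
- by move=> c _; rewrite mule_ge0 ?k0// uniform02_ge0.
- by apply: emeasurable_funD => //; exact: measurable_funeM.
move=> c _; rewrite EFinM muleCA -muleDr//; last first.
  by rewrite ge0_adde_def// inE ?k0// mule_ge0// lee_fin rsqrt_ge0.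
by rewrite lee_wpmul2l// uniform02_ge0.
Qed.

Lemma convolution0 (R : realType) (f : R -> \bar R) y : convolution f (cst 0%E) y = 0%E.
Proof. by rewrite /convolution integral0_eq// => s _; rewrite mule0. Qed.

(** The comparison is used once for each of the two mixtures. *)
Lemma convolution_gwo_bound (R : realType) (a p p' x x' y : R) : 0 <= a ->
  (convolution (gwo_edensity a p x) (gwo_edensity a p' x') y <=
   2^-1%:E * mean_rsqrt a p' x' * mean_rsqrt a p x)%E.
Proof.
move=> a0.
have h0 := gwo_edensity_ge0 a. have hm := measurable_gwo_edensity a.
have kE c p1 x1 F : measurable_fun setT F -> (forall z, 0 <= F z)%E ->
    convolution F (gwo_kernel a p1 x1 c) y = convolution (gwo_kernel a p1 x1 c) F y.
  move=> mF F0; rewrite convolutionC//; last exact: gwo_kernel_ge0.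
  exact: measurable_kernel1 (measurable_gwo_kernel _ _ _).
have := @convolution_gwo_compare R a p x (gwo_edensity a p' x') (cst 0%E) y y
  (2^-1%:E * mean_rsqrt a p' x').
rewrite convolution0 add0e; apply => //.
  by rewrite mule_ge0// mean_rsqrt_ge0.
move=> c; rewrite convolution0 add0e -kE//.
have := @convolution_gwo_compare R a p' x' (gwo_kernel a p x c) (cst 0%E) y y
  (2^-1 * rsqrt (half_width a p x c))%:E.
rewrite convolution0 add0e EFinM muleAC; apply => //.
- exact: measurable_kernel1 (measurable_gwo_kernel _ _ _).
- exact: gwo_kernel_ge0.
- by rewrite lee_fin mulr_ge0 ?rsqrt_ge0.
move=> c'; rewrite convolution0 add0e -!EFinM mulrAC.
by apply: convolution_unif_le; exact: half_width_ge0.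
Qed.

(** Two intervals of the same length whose centres differ by [v - v'] differ, on
the side that matters, by an interval of length [`|v - v'|]. *)
Lemma unif_around_shift (R : realType) (p r v v' : R) : 0 <= r ->
  exists l u : R, [/\ l <= u, u - l = `|v - v'| & forall t,
    (unif_around p r (v - t) <= unif_around p r (v' - t) +
      ((2 * r)^-1)%:E * (\1_(`[l, u]%classic) t)%:E)%E].
Proof.
move=> r0.
have key l u : (forall t, p - r <= v - t <= p + r ->
    (p - r <= v' - t <= p + r) || (l <= t <= u)) -> forall t,
    (unif_around p r (v - t) <= unif_around p r (v' - t) +
      ((2 * r)^-1)%:E * (\1_(`[l, u]%classic) t)%:E)%E.
  move=> h t; rewrite -EFinM -EFinD lee_fin indicE /uniform_pdf.
  have wE : p + r - (p - r) = 2 * r by ring.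
  have w0 : 0 <= (2 * r)^-1 by rewrite invr_ge0 mulr_ge0.
  rewrite wE; case: ifPn => [/h|_]; last first.
    by rewrite addr_ge0//; [case: ifPn|rewrite mulr_ge0].
  case: (boolP (p - r <= v' - t <= p + r)) => /= [_ _|_ tlu].
    by rewrite lerDl mulr_ge0.
  by rewrite mem_set ?mulr1 ?add0r//= in_itv.
have [vv'|v'v] := leP v v'.
- exists (v - p - r), (v' - p - r); split; [lra|rewrite distrC ger0_norm ?subr_ge0//; ring|].
  by apply: key => t ?; lra.
- exists (v' - p + r), (v - p + r); split; [lra|rewrite gtr0_norm ?subr_gt0//; ring|].
  by apply: key => t ?; lra.
Qed.

Lemma convolution_unif_lipschitz (R : realType) (p r v v' K : R) (G : R -> \bar R) :
  0 <= r -> measurable_fun setT G -> (forall z, 0 <= G z)%E -> (forall z, G z <= K%:E)%E ->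
  (convolution (unif_around p r) G v <=
   convolution (unif_around p r) G v' + (K * (2 * r)^-1 * `|v - v'|)%:E)%E.
Proof.
move=> r0 mG G0 GK.
have K0 : 0 <= K by rewrite -lee_fin (le_trans (G0 0)).
have mu' := measurable_unif_around p r; have u0 := unif_around_ge0 p r.
have w0 : 0 <= (2 * r)^-1 by rewrite invr_ge0 mulr_ge0.
have [l [u [lu ulE h]]] := unif_around_shift p v v' r0.
rewrite !(convolutionC _ mu' mG)//.
have mI : measurable_fun setT (fun t : R => (\1_(`[l, u]%classic) t)%:E : \bar R).
  by apply/measurable_EFinP; exact: measurable_indic.
have -> : ((K * (2 * r)^-1 * `|v - v'|)%:E =
    \int[mu]_t ((K * (2 * r)^-1)%:E * (\1_(`[l, u]%classic) t)%:E))%E.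
  rewrite ge0_integralZl// ?lee_fin ?mulr_ge0//.
  rewrite integral_indic// setIT [X in (_ * X)%E](_ : _ = `|v - v'|%:E) -?EFinM//.
  transitivity (lebesgue_measure `[l, u]%classic); first by [].
  rewrite lebesgue_measure_itv/= lte_fin; case: ltP => // ul; first by rewrite -EFinD ulE.
  by rewrite -ulE; congr EFin; lra.
have m1 y : measurable_fun setT (fun t => G t * unif_around p r (y - t))%E.
  by apply: emeasurable_funM => //; exact: measurable_shifted.
have m2 : measurable_fun setT
    (fun t : R => (K * (2 * r)^-1)%:E * (\1_(`[l, u]%classic) t)%:E : \bar R)%E.
  exact: measurable_funeM.
have i0 (t : R) : (0 <= (K * (2 * r)^-1)%:E * (\1_(`[l, u]%classic) t)%:E)%E.
  by rewrite -EFinM lee_fin mulr_ge0// mulr_ge0.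
have j0 y t : (0 <= G t * unif_around p r (y - t))%E by rewrite mule_ge0.
rewrite /convolution -ge0_integralD//; last exact: m1.
apply: ge0_le_integral => //.
- exact: m1.
- by apply: emeasurable_funD => //; exact: m1.
move=> t _; apply: (@le_trans _ _ (G t * (unif_around p r (v' - t) +
      ((2 * r)^-1)%:E * (\1_(`[l, u]%classic) t)%:E))%E).
  by rewrite lee_wpmul2l.
rewrite ge0_muleDr//; last by rewrite -EFinM lee_fin mulr_ge0.
rewrite leeD2l// EFinM -muleA lee_wpmul2r//.
by rewrite -EFinM lee_fin mulr_ge0.
Qed.

(** The difference is at most [K] and, by the Lipschitz bound, at most
[K * `|v - v'| / (2 * r)]; the smaller of the two is below the geometric mean
[K * sqrt (`|v - v'| / r)].  The Lipschitz constant itself is not integrable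
when [r] runs over the half-widths, but its square root is. *)
Lemma convolution_unif_holder (R : realType) (p r v v' K : R) (G : R -> \bar R) :
  0 <= r -> measurable_fun setT G -> (forall z, 0 <= G z)%E -> (forall z, G z <= K%:E)%E ->
  (convolution (unif_around p r) G v <=
   convolution (unif_around p r) G v' +
     (K * Num.sqrt `|v - v'|)%:E * (rsqrt r)%:E)%E.
Proof.
move=> r0 mG G0 GK.
have K0 : 0 <= K by rewrite -lee_fin (le_trans (G0 0)).
have c0 y : (0 <= convolution (unif_around p r) G y)%E.
  by apply: convolution_ge0 => //; exact: unif_around_ge0.
move: r0; rewrite le_eqVlt => /predU1P[r00|r0].
  rewrite {1}/convolution integral0_eq; last first.
    by move=> s _; rewrite -r00 unif_around_eq0// mul0e.
  by rewrite adde_ge0// -EFinM lee_fin !mulr_ge0 ?rsqrt_ge0 ?sqrtr_ge0.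
set t := `|v - v'|; have t0 : 0 <= t by rewrite normr_ge0.
have rE : rsqrt r = (Num.sqrt r)^-1 by rewrite rsqrtE// ltW.
have sr0 : 0 < Num.sqrt r by rewrite sqrtr_gt0.
have [rt|tr] := leP r t.
  apply: (@le_trans _ _ K%:E).
    apply: le_trans (convolution_le _ (measurable_unif_around _ _) mG _ G0 GK) _.
      exact: unif_around_ge0.
    by rewrite -[leRHS]mule1 lee_wpmul2l ?lee_fin// integral_unif_around_le1.
  rewrite -[leLHS]add0e leeD// -EFinM lee_fin rE -mulrA ler_peMr//.
  by rewrite ler_pdivlMr// mul1r ler_sqrt.
apply: le_trans (convolution_unif_lipschitz p v v' (ltW r0) mG G0 GK) _.
rewrite leeD2l// -EFinM lee_fin -!mulrA ler_wpM2l// -/t rE.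
rewrite mulrC ler_pdivrMr ?mulr_gt0//.
rewrite -{1}(sqr_sqrtr t0) -{2}(sqr_sqrtr (ltW r0)).
have -> : Num.sqrt t / Num.sqrt r * (2 * Num.sqrt r ^+ 2) = Num.sqrt t * (2 * Num.sqrt r).
  by field; rewrite gt_eqF.
rewrite expr2 ler_wpM2l ?sqrtr_ge0//.
have : Num.sqrt t <= Num.sqrt r by rewrite ler_sqrt// ltW.
lra.
Qed.

Lemma convolution_gwo_holder (R : realType) (a p x K v v' : R) (G : R -> \bar R) :
  0 <= a -> measurable_fun setT G -> (forall z, 0 <= G z)%E -> (forall z, G z <= K%:E)%E ->
  (convolution (gwo_edensity a p x) G v <=
   convolution (gwo_edensity a p x) G v' +
     (K * Num.sqrt `|v - v'|)%:E * mean_rsqrt a p x)%E.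
Proof.
move=> a0 mG G0 GK.
have K0 : 0 <= K by rewrite -lee_fin (le_trans (G0 0)).
apply: convolution_gwo_compare => //; first by rewrite lee_fin mulr_ge0 ?sqrtr_ge0.
by move=> c; apply: convolution_unif_holder => //; exact: half_width_ge0.
Qed.

(** * Integrability of the inverse square root of the half-width *)

Lemma integral_rsqrt_itv (R : realType) (u M : R) : 0 < u -> u < M ->
  (\int[mu]_(y in `[u, M]) (rsqrt y)%:E <= (2 * Num.sqrt M)%:E)%E.
Proof.
move=> u0 uM; have M0 : 0 < M by exact: lt_trans uM.
pose F (y : R) := 2 * y `^ (2^-1).
have dF (y : R) : 0 < y -> is_derive y 1 F (rsqrt y).
  move=> y0; have h := is_derive1_powR (2^-1 : R) y0.
  have -> : rsqrt y = 2 *: (2^-1 * y `^ (2^-1 - 1)).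
    rewrite /GRing.scale/= mulrA divff ?mul1r//; congr (_ `^ _); lra.
  exact: is_deriveZ.
have cF (y : R) : 0 < y -> {for y, continuous F}.
  move=> y0; apply: differentiable_continuous; apply/derivable1_diffP.
  by have [] := dF _ y0.
rewrite (@continuous_FTC2 _ _ F)//.
- rewrite -EFinB lee_fin /F (powR12_sqrt (ltW u0)) (powR12_sqrt (ltW M0)) lerBlDr lerDl mulr_ge0// sqrtr_ge0.
- apply: continuous_in_subspaceT => y; rewrite inE/= in_itv/= => /andP[uy _].
  have y0 : 0 < y by exact: lt_le_trans uy.
  apply: differentiable_continuous; apply/derivable1_diffP.
  by have [] := is_derive1_powR (- 2^-1 : R) y0.
- split.
  + move=> y; rewrite in_itv/= => /andP[uy _].
    by have [] := dF y (lt_trans u0 uy).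
  + by apply: cvg_at_right_filter; exact: cF.
  + by apply: cvg_at_left_filter; exact: cF.
- move=> y; rewrite in_itv/= => /andP[uy _]; rewrite derive1E.
  by have [_ ->] := dF y (lt_trans u0 uy).
Qed.

(** Exhaust [`]0, M]] by the intervals [`[M / n.+2, M]], on which the primitive
[2 * sqrt y] bounds the integrals uniformly. *)
Lemma integral_rsqrt (R : realType) (M : R) : 0 < M ->
  (\int[mu]_(y in `]0%R, M]) (rsqrt y)%:E <= (2 * Num.sqrt M)%:E)%E.
Proof.
move=> M0.
pose F (n : nat) : set R := `[M / n.+2%:R, M]%classic.
have FE : \bigcup_n F n = `]0, M]%classic.
  apply/seteqP; split => [y [n _]|y]; rewrite /F/= !in_itv/= => /andP[h1 h2].
    by rewrite h2 andbT (lt_le_trans _ h1)// divr_gt0.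
  have := archi_boundP (ltW (divr_gt0 M0 h1)); set n := Num.bound _ => hn.
  exists n => //=; rewrite in_itv/= h2 andbT.
  rewrite ler_pdivrMr//; move: hn; rewrite ltr_pdivrMr// => /ltW/le_trans; apply.
  by rewrite mulrC ler_wpM2l ?(ltW h1)// ler_nat -addn2 leq_addr.
have mF n : measurable (F n) by exact: measurable_itv.
have mr D : measurable_fun D (fun y : R => (rsqrt y)%:E).
  by apply/measurable_EFinP; apply: measurable_funTS; exact: measurable_rsqrt.
have ndF : nondecreasing_seq F.
  move=> m n mn; rewrite subsetEset => y; rewrite /F/= !in_itv/= => /andP[h ->].
  by rewrite andbT (le_trans _ h)// ler_wpM2l ?(ltW M0)// lef_pV2 ?posrE// ler_nat !ltnS.
have := @ge0_nondecreasing_set_cvg_integral _ (measurableTypeR R) R F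
  (fun y => (rsqrt y)%:E) mu ndF mF (fun i => mr (F i)).
have r0 i x : F i x -> (0 <= (rsqrt x)%:E)%E by rewrite lee_fin rsqrt_ge0.
move=> /(_ r0); rewrite FE => cv.
rewrite -(cvg_lim _ cv)//; apply: lime_le; first by apply/cvg_ex; eexists; exact: cv.
apply: nearW => n; apply: integral_rsqrt_itv; first by rewrite divr_gt0.
by rewrite ltr_pdivrMr// ltr_pMr// ltr1n.
Qed.

(** The parameter [c] lies within distance [1] of [1], and
[c * p - x = (c - 1) * p - (x - p)]. *)
Lemma half_width_le (R : realType) (a p x c : R) : 0 <= a -> 0 <= c <= 2 ->
  half_width a p x c <= gwo_radius a p x.
Proof.
move=> a0 /andP[c0 c2]; rewrite ler_wpM2l//.
have -> : c * p - x = (c - 1) * p - (x - p) by ring.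
apply: le_trans (ler_normB _ _) _; rewrite lerD2r normrM.
by rewrite ler_piMl// ler_norml; lra.
Qed.

(** Supported on the positive half-line; [rsqrt `|z|] is recovered from the
values at [z] and [- z]. *)
Definition rsqrt_trunc (R : realType) (M z : R) : R :=
  \1_(`]0, M]%classic) z * rsqrt z.

Lemma rsqrt_trunc_ge0 (R : realType) (M z : R) : 0 <= rsqrt_trunc M z.
Proof. by rewrite mulr_ge0 ?rsqrt_ge0. Qed.

Lemma measurable_rsqrt_trunc (R : realType) (M : R) :
  measurable_fun setT (EFin \o rsqrt_trunc M).
Proof.
apply/measurable_EFinP; apply: measurable_funM; last exact: measurable_rsqrt.
exact: measurable_indic.
Qed.

Lemma integral_rsqrt_trunc_lty (R : realType) (M : R) : 0 < M ->
  (\int[mu]_z (EFin \o rsqrt_trunc M) z < +oo)%E.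
Proof.
move=> M0; apply: (@le_lt_trans _ _ (2 * Num.sqrt M)%:E); last by rewrite ltry.
apply: le_trans (integral_rsqrt M0); rewrite [leRHS]integral_indicE//.
by apply/measurable_EFinP; exact: measurable_rsqrt.
Qed.

Lemma rsqrt_norm_le (R : realType) (M z : R) : `|z| <= M ->
  rsqrt `|z| <= rsqrt_trunc M z + rsqrt_trunc M (- z).
Proof.
have pos y : 0 < y -> y <= M -> rsqrt_trunc M y = rsqrt y.
  by move=> y0 yM; rewrite /rsqrt_trunc indicE mem_set ?mul1r//= in_itv/= y0.
have [z0|z0|->] := ltgtP z 0.
- rewrite ltr0_norm// => zM; rewrite -(pos (- z)) ?oppr_gt0//.
  by rewrite lerDr rsqrt_trunc_ge0.
- by rewrite gtr0_norm// => zM; rewrite -(pos z)// lerDl rsqrt_trunc_ge0.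
- rewrite normr0 {1}/rsqrt powR0 ?oppr_eq0 ?invr_eq0// => _.
  by rewrite addr_ge0// rsqrt_trunc_ge0.
Qed.

Lemma weighted_rsqrt_le (R : realType) (a p x c : R) : 0 < a ->
  uniform_pdf 0 2 c * rsqrt (half_width a p x c) <=
  rsqrt a * (rsqrt_trunc (`|p| + `|x - p|) (p * c + - x) +
             rsqrt_trunc (`|p| + `|x - p|) (- p * c + x)).
Proof.
move=> a0; rewrite /uniform_pdf; case: ifPn => [c02|_]; last first.
  by rewrite mul0r mulr_ge0 ?addr_ge0 ?rsqrt_trunc_ge0 ?rsqrt_ge0.
have rE : rsqrt (half_width a p x c) = rsqrt a * rsqrt `|p * c - x|.
  by rewrite /half_width /rsqrt powRM ?normr_ge0 ?(ltW a0)// (mulrC c).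
have zM : `|p * c - x| <= `|p| + `|x - p|.
  have := @half_width_le R 1 p x c ler01 c02.
  by rewrite /half_width /gwo_radius !mul1r (mulrC c).
apply: (@le_trans _ _ (rsqrt (half_width a p x c))).
  by rewrite ler_piMl ?rsqrt_ge0// subr0; lra.
rewrite rE ler_wpM2l ?rsqrt_ge0//.
have -> : - p * c + x = - (p * c - x) by ring.
exact: rsqrt_norm_le.
Qed.

Lemma integral_affine_lty (R : realType) (r q : R) (f : R -> \bar R) : r != 0 ->
  measurable_fun setT f -> (forall z, 0 <= f z)%E ->
  (\int[mu]_z f z < +oo -> \int[mu]_z f (r * z + q)%R < +oo)%E.
Proof.
move=> r0 mf f0; rewrite (ge0_integral_affine q r0 mf f0) !ltey.
by apply: contra_neq => ->; rewrite mulry gtr0_sg ?normr_gt0// mul1e.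
Qed.

(** For [p = 0] the half-width is constant and positive.  Otherwise the
substitution [z = p * c - x] reduces the claim to the integrability of
[`|z| ^ (- 1 / 2)] near [0]. *)
Lemma mean_rsqrt_lty (R : realType) (a p x : R) : 0 < a -> 0 < `|p| + `|x - p| ->
  (mean_rsqrt a p x < +oo)%E.
Proof.
move=> a0 px0.
have [p0|p0] := eqVneq p 0.
  have -> : mean_rsqrt a p x =
      (\int[mu]_c ((rsqrt (a * `|x|))%:E * (uniform_pdf 0 2 c)%:E))%E.
    apply: eq_integral => c _.
    by rewrite -EFinM /half_width p0 mulr0 sub0r normrN mulrC.
  rewrite ge0_integralZl//; last 3 first.
  - exact: measurable_uniform02.
  - by move=> c _; exact: uniform02_ge0.
  - by rewrite lee_fin rsqrt_ge0.
  by rewrite integral_uniform_pdf1// mule1 ltry.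
set M := `|p| + `|x - p| in px0.
have mT := measurable_rsqrt_trunc M.
have T0 z : (0 <= (EFin \o rsqrt_trunc M) z)%E by rewrite lee_fin rsqrt_trunc_ge0.
have Tfin := integral_rsqrt_trunc_lty px0.
have Np0 : - p != 0 by rewrite oppr_eq0.
pose f1 c := (EFin \o rsqrt_trunc M) (p * c + - x).
pose f2 c := (EFin \o rsqrt_trunc M) (- p * c + x).
have f1fin : (\int[mu]_c f1 c < +oo)%E by exact: integral_affine_lty.
have f2fin : (\int[mu]_c f2 c < +oo)%E by exact: integral_affine_lty.
have mf1 : measurable_fun setT f1 by exact: (measurableT_comp mT (measurable_affine _ _)).
have mf2 : measurable_fun setT f2 by exact: (measurableT_comp mT (measurable_affine _ _)).
have f10 c : (0 <= f1 c)%E by exact: T0.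
have f20 c : (0 <= f2 c)%E by exact: T0.
have bnd c : ((uniform_pdf 0 2 c * rsqrt (half_width a p x c))%:E <=
    (rsqrt a)%:E * (f1 c + f2 c))%E.
  by rewrite -EFinD -EFinM lee_fin; exact: weighted_rsqrt_le.
clearbody f1 f2.
have mD : measurable_fun setT (fun c => (f1 c + f2 c)%E) by exact: emeasurable_funD.
have D0 c : (0 <= f1 c + f2 c)%E by exact: adde_ge0.
apply: (@le_lt_trans _ _ (\int[mu]_c ((rsqrt a)%:E * (f1 c + f2 c)))%E).
  apply: ge0_le_integral => // [c _| |].
  - by rewrite lee_fin mulr_ge0 ?uniform_pdf_nneg ?rsqrt_ge0.
  - exact: measurable_weighted_rsqrt.
  - exact: measurable_funeM.
rewrite ge0_integralZl ?lee_fin ?rsqrt_ge0// ge0_integralD//.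
by rewrite lte_mul_pinfty ?lee_fin ?rsqrt_ge0// lte_add_pinfty.
Qed.

(** * The set where a convolution is positive *)

Lemma integral_gt0_itv (R : realType) (f : R -> \bar R) (l u : R) :
  measurable_fun setT f -> (forall z, 0 <= f z)%E -> l < u ->
  (forall z, l < z < u -> (0 < f z)%E) -> (0 < \int[mu]_z f z)%E.
Proof.
move=> mf f0 lu fpos; rewrite lt_neqAle integral_ge0// andbT eq_sym.
apply/negP => /eqP int0.
have /(ae_eq_integral_abs mu measurableT mf) [N [mN N0 fN]] :
    (\int[mu]_z `|f z| = 0)%E.
  by rewrite -int0; apply: eq_integral => z _; rewrite gee0_abs.
have : (lebesgue_measure `]l, u[%classic <= lebesgue_measure N)%E.
  apply: le_measure; rewrite ?inE//; apply: subset_trans fN => z /=.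
  rewrite in_itv/= => /fpos fz /(_ I) fz0.
  by rewrite fz0 ltxx in fz.
rewrite [X in (_ <= X)%E -> _]N0 lebesgue_measure_itv/= lte_fin lu -EFinB lee_fin.
by rewrite subr_le0 leNgt lu.
Qed.

(** Nothing is required on the sphere [`|z - p| = n]: it is a null set, and the
values there differ between versions of a density. *)
Definition ball_support (R : realType) (f : R -> \bar R) (p n : R) : Prop :=
  (forall z, `|z - p| < n -> (0 < f z)%E) /\ (forall z, n < `|z - p| -> f z = 0%E).

(** The open intervals on which the two factors of the integrand are positive
overlap in an open interval. *)
Lemma convolution_gt0 (R : realType) (f g : R -> \bar R) (p q m n y : R) :
  measurable_fun setT f -> measurable_fun setT g ->
  (forall z, 0 <= f z)%E -> (forall z, 0 <= g z)%E -> 0 < m -> 0 < n ->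
  ball_support f p m -> ball_support g q n ->
  `|y - (p + q)| < m + n -> (0 < convolution f g y)%E.
Proof.
move=> mf mg f0 g0 m0 n0 [fpos _] [gpos _]; rewrite ltr_norml => /andP[h1 h2].
apply: (@integral_gt0_itv _ _ (Num.max (p - m) (y - q - n)) (Num.min (p + m) (y - q + n))).
- by apply: emeasurable_funM => //; exact: measurable_shifted.
- by move=> z; exact: mule_ge0.
- by rewrite gt_max !lt_min; apply/andP; split; apply/andP; split; lra.
move=> s; rewrite gt_max lt_min => /andP[/andP[s1 s2] /andP[s3 s4]].
by apply: mule_gt0; [apply: fpos|apply: gpos]; rewrite ltr_norml; lra.
Qed.

(** By the triangle inequality both factors can be nonzero only when [s] is an
endpoint of the interval that carries [f]. *)
Lemma convolution_eq0 (R : realType) (f g : R -> \bar R) (p q m n y : R) :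
  measurable_fun setT f -> measurable_fun setT g ->
  ball_support f p m -> ball_support g q n ->
  m + n <= `|y - (p + q)| -> convolution f g y = 0%E.
Proof.
move=> mf mg [_ fout] [_ gout] h.
transitivity (\int[@lebesgue_measure R]_s (cst 0 : R -> \bar R) s)%E; last by rewrite integral0.
apply: ae_eq_integral => //.
  by apply: emeasurable_funM => //; exact: measurable_shifted.
exists ([set p - m] `|` [set p + m]); split.
- exact: measurableU.
- apply/eqP; rewrite -measure_le0; apply: le_trans (measureU2 _ _ _) _ => //.
  by rewrite [X in (X + _)%E]lebesgue_measure_set1 [X in (_ + X)%E]lebesgue_measure_set1 adde0.
move=> s /= /not_implyP[_ hs].
apply: contrapT => /not_orP[h1 h2]; apply: hs.
have [ms|sm] := ltP m `|s - p|; first by rewrite fout// mul0e.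
have [ns|sn] := ltP n `|(y - s) - q|; first by rewrite gout// mule0.
exfalso.
have tri : `|y - (p + q)| <= `|s - p| + `|(y - s) - q|.
  by apply: le_trans (ler_normD _ _); rewrite le_eqVlt; apply/orP; left; apply/eqP; congr (`|_|); ring.
have : `|s - p| = m by lra.
have [sp|sp] := leP 0 (s - p).
  by rewrite ger0_norm// => e1; apply: h2; lra.
by rewrite ltr0_norm// => e1; apply: h1; lra.
Qed.

Lemma ball_support_convolution (R : realType) (f g : R -> \bar R) (p q m n : R) :
  measurable_fun setT f -> measurable_fun setT g ->
  (forall z, 0 <= f z)%E -> (forall z, 0 <= g z)%E -> 0 < m -> 0 < n ->
  ball_support f p m -> ball_support g q n ->
  ball_support (convolution f g) (p + q) (m + n).
Proof.
move=> mf mg f0 g0 m0 n0 hf hg; split => z hz.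
  exact: convolution_gt0 hf hg hz.
exact: convolution_eq0 hf hg (ltW hz).
Qed.

Lemma normD_same_sign (R : realType) (u v : R) : 0 <= u * v -> `|u + v| = `|u| + `|v|.
Proof.
have [u0|u0] := leP 0 u; have [v0|v0] := leP 0 v.
- by move=> _; rewrite !ger0_norm// addr_ge0.
- rewrite nmulr_lge0// => u0'; have -> : u = 0 by lra.
  by rewrite normr0 !add0r.
- rewrite nmulr_rge0// => v0'; have -> : v = 0 by lra.
  by rewrite normr0 !addr0.
- by move=> _; rewrite !ltr0_norm//; lra.
Qed.

(** The half-width is at most [gwo_radius a p x] for [c] in [0, 2], which gives
vanishing outside.  The maximum is attained at one of the ends [0] and [2],
according to the sign of [p * (p - x)], and the half-width is Lipschitz in
[c]; hence it exceeds [`|z - p|] on an open interval of parameters next to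
that end. *)
Lemma gwo_edensity_support (R : realType) (a p x : R) : 0 < a ->
  0 < `|p| + `|x - p| ->
  ball_support (gwo_edensity a p x) p (gwo_radius a p x).
Proof.
move=> a0 px0; split => z hz.
- have n0 : 0 < gwo_radius a p x by apply: le_lt_trans hz.
  (* the half-width is Lipschitz in c with constant a * `|p|; adding 1 avoids a
     division by 0 when p = 0 *)
  pose eta := (gwo_radius a p x - `|z - p|) / (a * `|p| + 1).
  have ap0 : 0 <= a * `|p| by rewrite mulr_ge0// ltW.
  have eta0 : 0 < eta by rewrite divr_gt0 ?subr_gt0//; lra.
  have mono c c0 : `|c0 * p - x| = `|p| + `|x - p| -> `|c - c0| < eta ->
      `|z - p| < half_width a p x c.
    move=> hc0 cc0.
    have e1 : `|c - c0| * (a * `|p|) < gwo_radius a p x - `|z - p|.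
      apply: (@le_lt_trans _ _ (`|c - c0| * (a * `|p| + 1))).
        by rewrite ler_wpM2l// lerDl.
      rewrite -ltr_pdivlMr//; lra.
    have e2 : `|c0 * p - x| <= `|c * p - x| + `|c - c0| * `|p|.
      rewrite -normrM -(normrN ((c - c0) * p)); apply: le_trans (ler_normD _ _).
      by rewrite le_eqVlt; apply/orP; left; apply/eqP; congr (`|_|); ring.
    have e3 : gwo_radius a p x <= half_width a p x c + `|c - c0| * (a * `|p|).
      rewrite /gwo_radius -hc0 /half_width mulrCA -mulrDr.
      by rewrite ler_wpM2l// ltW.
    lra.
  have pos c : 0 < c < 2 -> `|z - p| < half_width a p x c ->
      (0 < (EFin \o uniform_pdf 0 2) c * gwo_kernel a p x c z)%E.
    move=> c02; rewrite ltr_norml => /andP[h1 h2].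
    have r0 : 0 < half_width a p x c by lra.
    apply: mule_gt0; rewrite lte_fin /uniform_pdf.
      by rewrite ifT ?invr_gt0; lra.
    by rewrite ifT ?invr_gt0; lra.
  have mk : measurable_fun setT
      (fun c => (EFin \o uniform_pdf 0 2) c * gwo_kernel a p x c z)%E.
    apply: emeasurable_funM; first exact: measurable_uniform02.
    exact: measurable_kernel2 (measurable_gwo_kernel _ _ _).
  have k0 c : (0 <= (EFin \o uniform_pdf 0 2) c * gwo_kernel a p x c z)%E.
    by rewrite mule_ge0 ?uniform02_ge0 ?gwo_kernel_ge0.
  have [ppx|ppx] := leP 0 (p * (p - x)).
    apply: (@integral_gt0_itv _ _ (Num.max 0 (2 - eta)) 2) => //.
      by rewrite gt_max; apply/andP; split; lra.
    move=> c; rewrite gt_max => /andP[/andP[c0 ceta] c2].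
    apply: pos; first by rewrite c0.
    apply: (mono c 2); last by rewrite ltr_norml; lra.
    have -> : 2 * p - x = p + (p - x) by ring.
    by rewrite (distrC x) normD_same_sign.
  apply: (@integral_gt0_itv _ _ 0 (Num.min 2 eta)) => //.
    by rewrite lt_min; apply/andP; split; lra.
  move=> c; rewrite lt_min => /andP[c0 /andP[c2 ceta]].
  apply: pos; first by rewrite c0.
  apply: (mono c 0); last by rewrite ltr_norml; lra.
  rewrite mul0r sub0r normrN (distrC x) -(normrN (p - x)) -normD_same_sign.
    by congr (`|_|); ring.
  by rewrite mulrN oppr_ge0 ltW.
- rewrite /gwo_edensity /mixture integral0_eq// => c _.
  rewrite /= /gwo_kernel /unif_around -EFinM.
  have [c02|] := boolP (0 <= c <= 2); last first.
    by rewrite /uniform_pdf => /negbTE ->; rewrite mul0r.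
  have h := half_width_le p x (ltW a0) c02.
  rewrite [X in _ * X](_ : _ = 0) ?mulr0// /uniform_pdf ifF//.
  apply/negbTE/negP => /andP[h1 h2]; move: hz; rewrite ltNge => /negP; apply.
  by apply: le_trans h; rewrite ler_norml; lra.
Qed.

(** * Independence of the three summands *)

(** One step of the passage from rectangles to measurable sets: only the event of
the pair [(U, V)] changes, while [E1] and [E2] collect the events of the pairs
already treated and of those still to be treated. *)
Lemma independent_pair_events (R : realType) (d : measure_display)
    (Omega : measurableType d) (P : probability Omega R) (U V : {RV P >-> R})
    (E1 E2 : set Omega) : measurable E1 -> measurable E2 ->
  (forall B1 B2 : set R, measurable B1 -> measurable B2 ->
    P (U @^-1` B1 `&` V @^-1` B2) = P (U @^-1` B1) * P (V @^-1` B2))%E ->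
  (forall B1 B2 : set R, measurable B1 -> measurable B2 ->
    P (E1 `&` ((U @^-1` B1 `&` V @^-1` B2) `&` E2)) =
    P E1 * (P (U @^-1` B1 `&` V @^-1` B2) * P E2))%E ->
  forall D : set (R * R), measurable D ->
    P (E1 `&` (rv_pair U V @^-1` D `&` E2)) =
    (P E1 * (P (rv_pair U V @^-1` D) * P E2))%E.
Proof.
move=> mE1 mE2 indep rect D mD.
have PE : (P (E1 `&` E2) = P E1 * P E2)%E.
  have := rect _ _ measurableT measurableT.
  by rewrite !preimage_setT !setTI probability_setT mul1e.
rewrite setICA (product_law (measurableI _ _ mE1 mE2) _ mD).
  by rewrite (product_lawT indep mD) PE muleCA.
by move=> B1 B2 mB1 mB2; rewrite setICA rect// indep// PE muleCA.
Qed.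

Definition all_parameters (R : realType) (d : measure_display) (Omega : measurableType d)
    (P : probability Omega R) (A C : 'I_3 -> {RV P >-> R}) (i : 'I_3 + 'I_3) : {RV P >-> R} :=
  match i with inl k => A k | inr k => C k end.

Lemma indep_CA (R : realType) (d : measure_display) (Omega : measurableType d)
    (P : probability Omega R) (A C : 'I_3 -> {RV P >-> R}) k (B1 B2 : set R) :
  mutually_independent (all_parameters A C) ->
  measurable B1 -> measurable B2 ->
  (P (C k @^-1` B1 `&` A k @^-1` B2) = P (C k @^-1` B1) * P (A k @^-1` B2))%E.
Proof.
move=> hind mB1 mB2.
pose B (i : 'I_3 + 'I_3) := match i with inl _ => B2 | inr _ => B1 end.
have mB i : measurable (B i) by case: i.
have := hind (inr k |: [set inl k])%SET B mB.
rewrite big_setU1/= ?inE// big_set1 => <-; congr (P _).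
apply/seteqP; split => [w [w1 w2] i /=|w h].
  by rewrite !inE => /orP[]/eqP ->.
by split; [apply: (h (inr k))|apply: (h (inl k))]; rewrite /= !inE eqxx ?orbT.
Qed.

Lemma ord3_ind (Q : 'I_3 -> Prop) : Q 0 -> Q 1 -> Q 2 -> forall k, Q k.
Proof.
move=> Q0 Q1 Q2 [[|[|[|//]]] hk].
- by rewrite (_ : Ordinal hk = 0); last exact: val_inj.
- by rewrite (_ : Ordinal hk = 1); last exact: val_inj.
- by rewrite (_ : Ordinal hk = 2); last exact: val_inj.
Qed.

Definition parameter_rect (R : realType) (d : measure_display) (Omega : measurableType d)
    (P : probability Omega R) (A C : 'I_3 -> {RV P >-> R}) (c a : 'I_3 -> set R) k :=
  C k @^-1` c k `&` A k @^-1` a k.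

Lemma indep_rects (R : realType) (d : measure_display) (Omega : measurableType d)
    (P : probability Omega R) (A C : 'I_3 -> {RV P >-> R}) (c a : 'I_3 -> set R) :
  mutually_independent (all_parameters A C) ->
  (forall k, measurable (c k)) -> (forall k, measurable (a k)) ->
  let rect := parameter_rect A C c a in
  (P (rect 0%R `&` (rect 1%R `&` rect 2%R)) = P (rect 0%R) * (P (rect 1%R) * P (rect 2%R)))%E.
Proof.
move=> hind mc ma.
pose B (i : 'I_3 + 'I_3) := match i with inl k => a k | inr k => c k end.
have mB i : measurable (B i) by case: i.
have := hind [set: 'I_3 + 'I_3]%SET B mB.
rewrite (eq_bigl xpredT); last by move=> i; rewrite inE.
have e1 : lift ord0 ord0 = 1 :> 'I_3 by exact: val_inj.
have e2 : lift ord0 (lift ord0 ord0) = 2 :> 'I_3 by exact: val_inj.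
rewrite big_sumType/= !big_ord_recl !big_ord0 !mule1 e2 e1 => h.
rewrite /parameter_rect/= !indep_CA//.
transitivity (P (\bigcap_(i in [set` [set: 'I_3 + 'I_3]%SET]) (all_parameters A C i @^-1` B i))).
  congr (P _); apply/seteqP; split => [w /= [[w1 w2] [[w3 w4] [w5 w6]]] [i _|i _] /=|w hw /=].
  - by elim/ord3_ind: i.
  - by elim/ord3_ind: i.
  - by do ![split]; [apply: (hw (inr _))|apply: (hw (inl _))|apply: (hw (inr _))
      |apply: (hw (inl _))|apply: (hw (inr _))|apply: (hw (inl _))]; rewrite /= inE.
rewrite h muleACA [X in (_ * X)%E]muleACA.
by congr (_ * (_ * _))%E; exact: muleC.
Qed.

(** The three pairs are treated in turn, replacing a rectangle by an arbitrary
measurable set of pairs each time. *)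
Lemma indep_pairs (R : realType) (d : measure_display) (Omega : measurableType d)
    (P : probability Omega R) (A C : 'I_3 -> {RV P >-> R}) (D : 'I_3 -> set (R * R)) :
  mutually_independent (all_parameters A C) -> (forall k, measurable (D k)) ->
  let Y k := rv_pair (C k) (A k) @^-1` D k in
  (P (Y 0%R `&` (Y 1%R `&` Y 2%R)) = P (Y 0%R) * (P (Y 1%R) * P (Y 2%R)))%E.
Proof.
move=> hind mD Y.
have mY k : measurable (Y k).
  by apply: preimage_measurable => //; apply: measurable_rv_pair; exact: measurable_funP.
have mr k B1 B2 : measurable B1 -> measurable B2 ->
    measurable (C k @^-1` B1 `&` A k @^-1` B2).
  by move=> mB1 mB2; apply: measurableI; exact: measurable_funPTI.
have rects (c a : 'I_3 -> set R) (mc : forall k, measurable (c k))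
    (ma : forall k, measurable (a k)) :=
  indep_rects hind mc ma.
have iCA k (B1 B2 : set R) (m1 : measurable B1) (m2 : measurable B2) := indep_CA k hind m1 m2.
have f3 (B0 B1 B2 : set R) : measurable B0 -> measurable B1 -> measurable B2 ->
    exists2 c : 'I_3 -> set R, forall k, measurable (c k) &
      [/\ c 0 = B0, c 1 = B1 & c 2 = B2].
  move=> m0 m1 m2; exists (fun k => if k == 0 then B0 else if k == 1 then B1 else B2) => //.
  by elim/ord3_ind.
have S1 B1 B2 B3 B4 : measurable B1 -> measurable B2 -> measurable B3 -> measurable B4 ->
    (P (Y 0%R `&` ((C 1%R @^-1` B1 `&` A 1%R @^-1` B2) `&`
                   (C 2%R @^-1` B3 `&` A 2%R @^-1` B4))) =
     P (Y 0%R) * (P (C 1%R @^-1` B1 `&` A 1%R @^-1` B2) *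
                  P (C 2%R @^-1` B3 `&` A 2%R @^-1` B4)))%E.
  move=> m1 m2 m3 m4.
  have PT : (P (C 1%R @^-1` B1 `&` A 1%R @^-1` B2 `&` (C 2%R @^-1` B3 `&` A 2%R @^-1` B4)) =
     P (C 1%R @^-1` B1 `&` A 1%R @^-1` B2) * P (C 2%R @^-1` B3 `&` A 2%R @^-1` B4))%E.
    have [c mc [c0 c1 c2]] := f3 _ _ _ measurableT m1 m3.
    have [a ma [a0 a1 a2]] := f3 _ _ _ measurableT m2 m4.
    have := rects c a mc ma; rewrite /parameter_rect c0 a0 c1 a1 c2 a2.
    by rewrite !preimage_setT !setTI probability_setT mul1e.
  have := @independent_pair_events R d Omega P (C 0) (A 0) setT _ measurableT
    (measurableI _ _ (mr 1 _ _ m1 m2) (mr 2 _ _ m3 m4)) (@iCA 0).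
  rewrite PT probability_setT => /(_ _ _ (mD 0)).
  rewrite setTI mul1e; apply => B5 B6 m5 m6; rewrite setTI mul1e.
  have [c mc [c0 c1 c2]] := f3 _ _ _ m5 m1 m3.
  have [a ma [a0 a1 a2]] := f3 _ _ _ m6 m2 m4.
  by have := rects c a mc ma; rewrite /parameter_rect c0 a0 c1 a1 c2 a2.
have S2 B3 B4 : measurable B3 -> measurable B4 ->
    (P (Y 0%R `&` (Y 1%R `&` (C 2%R @^-1` B3 `&` A 2%R @^-1` B4))) =
     P (Y 0%R) * (P (Y 1%R) * P (C 2%R @^-1` B3 `&` A 2%R @^-1` B4)))%E.
  move=> m3 m4.
  apply: (@independent_pair_events R d Omega P (C 1) (A 1)) => //.
  - exact: mr.
  - exact: iCA.
  - by move=> B1 B2 m1 m2; exact: S1.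
have PY : (P (Y 0%R `&` Y 1%R) = P (Y 0%R) * P (Y 1%R))%E.
  have := S2 _ _ measurableT measurableT.
  by rewrite !preimage_setT !setIT probability_setT mule1.
have := @independent_pair_events R d Omega P (C 2) (A 2) (Y 0 `&` Y 1) setT
  (measurableI _ _ (mY 0) (mY 1)) measurableT (@iCA 2).
rewrite PY probability_setT => /(_ _ _ (mD 2)).
rewrite setIT mule1 -setIA -muleA; apply => B1 B2 m1 m2.
by rewrite setIT mule1 -setIA -muleA S2.
Qed.

(** * The density of the update *)

Lemma scale_edensity (R : realType) (d : measure_display) (Omega : measurableType d)
    (P : probability Omega R) (S : Omega -> R) (f : R -> \bar R) (r : R) : 0 < r ->
  has_edensity P S f ->
  has_edensity P (fun w => r^-1 * S w) (fun u => r%:E * f (r * u)%R)%E.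
Proof.
move=> r0 [mS mf f0 fE].
have mfr : measurable_fun setT (fun u => r%:E * f (r * u)%R)%E.
  by apply: measurable_funeM; exact: measurableT_comp.
split => //.
- exact: measurable_funM.
- by move=> u; rewrite mule_ge0// lee_fin ltW.
move=> B mB.
pose B' : set R := (fun s => r^-1 * s) @^-1` B.
have mB' : measurable B' by apply: preimage_measurable => //; exact: measurable_funM.
transitivity (P (S @^-1` B')); first by [].
have mI D : measurable D -> measurable_fun setT (fun z : R => (\1_D z)%:E : \bar R).
  by move=> mD; apply/measurable_EFinP; exact: measurable_indic.
rewrite fE// integral_indicE// [RHS]integral_indicE//.
rewrite (@ge0_integral_affine _ r 0) ?gt_eqF//; last 2 first.
- by apply: emeasurable_funM => //; exact: mI.
- by move=> z; rewrite mule_ge0// lee_fin.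
rewrite gtr0_norm// -ge0_integralZl//; last 3 first.
- have := measurableT_comp (emeasurable_funM (mI _ mB') mf) (measurable_affine r 0).
  exact.
- by move=> z _; rewrite mule_ge0// lee_fin.
- by rewrite lee_fin ltW.
apply: eq_integral => u _; rewrite addr0 muleCA; congr (_%:E * _)%E.
rewrite !indicE; congr (nat_of_bool _)%:R.
by apply/idP/idP; rewrite !inE /B'/= mulKf ?gt_eqF.
Qed.

(** An integrable function is almost everywhere finite. *)
Lemma edensity_density (R : realType) (d : measure_display) (Omega : measurableType d)
    (P : probability Omega R) (X : Omega -> R) (f : R -> \bar R) :
  has_edensity P X f -> has_density P X (fine \o f).
Proof.
move=> hf; have [mX mf f0 fE] := hf; apply/has_density_edensity.
split => //.
- by apply/measurable_EFinP; exact: measurableT_comp.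
- by move=> z; rewrite lee_fin fine_ge0.
move=> B mB; rewrite fE//; apply: ae_eq_integral => //.
- exact: measurable_funTS.
- by apply: measurable_funTS; apply/measurable_EFinP; exact: measurableT_comp.
have := integrable_ae measurableT (edensity_integrable hf).
apply: negligibleS => z /= h1 h2; apply: h1 => _ /=.
by rewrite fineK// h2.
Qed.

(** A one-sided inequality for all ordered pairs is an estimate of the absolute
value of the difference. *)
Lemma holder_continuous (R : realType) (phi : R -> R) (L : R) :
  (forall v v', phi v <= phi v' + L * Num.sqrt `|v - v'|) -> continuous phi.
Proof.
move=> h v; apply/cvgrPdist_le => /= e e0.
(* adding the inequalities for (v, v + 1) and (v + 1, v) shows L >= 0 *)
have L0 : 0 <= L.
  have := h v (v + 1); have := h (v + 1) v.
  rewrite (_ : v + 1 - v = 1); last by ring.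
  rewrite (_ : v - (v + 1) = - 1); last by ring.
  by rewrite normrN normr1 sqrtr1; lra.
have L1 : 0 < L + 1 by lra.
near=> v'.
have dv : `|v - v'| <= (e / (L + 1)) ^+ 2.
  near: v'; apply: cvgr_dist_le => //.
  by rewrite exprn_gt0// divr_gt0.
have sv : L * Num.sqrt `|v - v'| <= e.
  apply: (@le_trans _ _ ((L + 1) * (e / (L + 1)))).
    apply: ler_pM; rewrite ?sqrtr_ge0 ?lerDl//.
    have q0 : 0 <= e / (L + 1) by rewrite divr_ge0 ?(ltW e0) ?(ltW L1).
    by rewrite -(ger0_norm q0) -(sqrtr_sqr (e / (L + 1))) ler_wsqrtr.
  by rewrite mulrCA divff ?mulr1// gt_eqF.
have h1 := h v v'; have h2 := h v' v; rewrite (distrC v') in h2.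
rewrite ler_norml; lra.
Unshelve. all: by end_near. Qed.

Lemma rv_of_measurable (R : realType) (d : measure_display) (Omega : measurableType d)
    (P : probability Omega R) (X : Omega -> R) : measurable_fun setT X ->
  exists X' : {RV P >-> R}, X' = X :> (Omega -> R).
Proof.
move=> mX; pose X' : {RV P >-> R} := HB.pack X (@isMeasurableFun.Build _ _ Omega R X mX).
by exists X'.
Qed.

Lemma gwo_summands_independent (R : realType) (d : measure_display)
    (Omega : measurableType d) (P : probability Omega R)
    (p : 'I_3 -> R) (x : R) (A C : 'I_3 -> {RV P >-> R}) (B : 'I_3 -> set R) :
  mutually_independent (all_parameters A C) -> (forall k, measurable (B k)) ->
  let Y k := gwo_summand (p k) x (A k) (C k) @^-1` B k in
  (P (Y 0%R `&` (Y 1%R `&` Y 2%R)) = P (Y 0%R) * (P (Y 1%R) * P (Y 2%R)))%E.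
Proof.
move=> hind mB Y.
pose D k : set (R * R) := (fun ca => p k + ca.2 * `|ca.1 * p k - x|) @^-1` B k.
apply: (@indep_pairs R d Omega P A C D hind) => k.
apply: preimage_measurable => //.
apply: measurable_funD => //; apply: measurable_funM => //.
apply: measurableT_comp => //; apply: measurable_funB => //.
exact: measurable_funM.
Qed.

(** The first two summands are added, then the third, and the total is divided by
[3]; independence of the sum of the first two from the third comes from the
pair argument again. *)
Lemma gwo_update_edensity (R : realType) (d : measure_display)
    (Omega : measurableType d) (P : probability Omega R)
    (p : 'I_3 -> R) (x : R) (A C : 'I_3 -> {RV P >-> R}) (g : 'I_3 -> R -> R) :
  mutually_independent (all_parameters A C) ->
  (forall k, has_density P (gwo_summand (p k) x (A k) (C k)) (g k)) ->
  has_edensity P (gwo_update p x A C) (mean_density g).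
Proof.
move=> hind hg.
have hg' k := (@has_density_edensity _ _ _ P _ _).1 (hg k).
have rvX k : exists X' : {RV P >-> R}, X' = gwo_summand (p k) x (A k) (C k) :> (Omega -> R).
  by apply: rv_of_measurable; case: (hg k).
have [X0 X0E] := rvX 0; have [X1 X1E] := rvX 1; have [X2 X2E] := rvX 2.
have f3 (B0 B1 B2 : set R) : measurable B0 -> measurable B1 -> measurable B2 ->
    (P (X0 @^-1` B0 `&` (X1 @^-1` B1 `&` X2 @^-1` B2)) =
     P (X0 @^-1` B0) * (P (X1 @^-1` B1) * P (X2 @^-1` B2)))%E.
  move=> m0 m1 m2; rewrite X0E X1E X2E.
  pose B (k : 'I_3) := if k == 0 then B0 else if k == 1 then B1 else B2.
  have mB k : measurable (B k) by elim/ord3_ind: k.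
  exact: (@gwo_summands_independent R d Omega P p x A C B hind mB).
have i01 (B0 B1 : set R) : measurable B0 -> measurable B1 ->
    (P (X0 @^-1` B0 `&` X1 @^-1` B1) = P (X0 @^-1` B0) * P (X1 @^-1` B1))%E.
  move=> m0 m1; have := f3 _ _ _ m0 m1 measurableT.
  by rewrite preimage_setT setIT probability_setT mule1.
have d0 : has_edensity P X0 (EFin \o g 0) by rewrite X0E.
have d1 : has_edensity P X1 (EFin \o g 1) by rewrite X1E.
have d2 : has_edensity P X2 (EFin \o g 2) by rewrite X2E.
have d01 := sum_edensity i01 d0 d1.
have [X01 X01E] := rv_of_measurable P (let: And4 m _ _ _ := d01 in m).
rewrite -X01E in d01.
have i012 (B01 B2 : set R) : measurable B01 -> measurable B2 ->
    (P (X01 @^-1` B01 `&` X2 @^-1` B2) = P (X01 @^-1` B01) * P (X2 @^-1` B2))%E.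
  move=> m01 m2.
  pose D : set (R * R) := (fun uv => uv.1 + uv.2) @^-1` B01.
  have mD : measurable D by apply: preimage_measurable => //; exact: measurable_funD.
  have -> : X01 @^-1` B01 = rv_pair X0 X1 @^-1` D by rewrite X01E.
  have mX2 : measurable (X2 @^-1` B2) by exact: measurable_funPTI.
  have := @independent_pair_events R d Omega P X0 X1 setT (X2 @^-1` B2) measurableT mX2 i01.
  rewrite probability_setT => /(_ _ _ mD); rewrite setTI mul1e; apply => B0 B1 m0 m1.
  by rewrite setTI mul1e -setIA f3// i01// muleA.
have dS := scale_edensity (ltr0n R 3) (sum_edensity i012 d01 d2).
have -> // : gwo_update p x A C = (fun w => 3^-1 * (X01 \+ X2) w).
apply/funext => w; rewrite /gwo_update X01E X0E X1E X2E /= /gwo_summand.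
rewrite !big_ord_recl !big_ord0.
have -> : lift ord0 (lift ord0 ord0) = 2 :> 'I_3 by exact: val_inj.
have -> : lift ord0 ord0 = 1 :> 'I_3 by exact: val_inj.
ring.
Qed.

(** * The density of the sum of the three summands *)

Lemma integral_gwo_edensity_le1 (R : realType) (a p x : R) :
  (\int[mu]_z gwo_edensity a p x z <= 1)%E.
Proof.
have w0 := @uniform02_ge0 R; have mw := @measurable_uniform02 R.
have k0 := @gwo_kernel_ge0 R a p x; have mk := measurable_gwo_kernel a p x.
under eq_integral do rewrite -[gwo_edensity _ _ _ _]mule1.
rewrite (@integral_mixture R _ _ (cst 1%E))//.
apply: (@le_trans _ _ (\int[mu]_c (uniform_pdf 0 2 c)%:E)%E); last first.
  by rewrite integral_uniform_pdf1.
apply: ge0_le_integral => //.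
- by move=> c _; rewrite mule_ge0//; apply: integral_ge0 => z _; rewrite mule_ge0.
- apply: emeasurable_funM => //.
  apply: (@measurable_lebesgue_integral R (fun cz => gwo_kernel a p x cz.1 cz.2 * 1)%E).
    exact: emeasurable_funM.
  by move=> cz; rewrite mule_ge0.
move=> c _; rewrite -[leRHS]mule1 lee_wpmul2l ?lee_fin ?uniform_pdf_nneg//.
under eq_integral do rewrite mule1.
exact: integral_unif_around_le1.
Qed.

Definition gwo_sum_edensity (R : realType) (a : R) (p : 'I_3 -> R) (x : R) : R -> \bar R :=
  convolution (convolution (gwo_edensity a (p 0) x) (gwo_edensity a (p 1) x))
    (gwo_edensity a (p 2) x).

Lemma fine_holder (R : realType) (F : R -> \bar R) (K L : R) :
  (forall v, 0 <= F v)%E -> (forall v, F v <= K%:E)%E ->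
  (forall v v', F v <= F v' + (L * Num.sqrt `|v - v'|)%:E)%E ->
  exists phi : R -> R, [/\ forall v, F v = (phi v)%:E,
    forall v, 0 <= phi v <= K &
    forall v v', phi v <= phi v' + L * Num.sqrt `|v - v'|].
Proof.
move=> F0 FK FL.
have FE v : F v = (fine (F v))%:E.
  by rewrite fineK// ge0_fin_numE// (le_lt_trans (FK v))// ltry.
exists (fine \o F); split => [//|v|v v'] /=.
  by rewrite -!lee_fin -FE F0 FK.
by rewrite -lee_fin EFinD -!FE.
Qed.

(** The convolution [G] of two summand densities is bounded, which is all that the
convolution with the third one needs to be bounded and Hölder continuous. *)
Lemma gwo_sum_edensity_regular (R : realType) (a : R) (p : 'I_3 -> R) (x : R) :
  0 < a -> (forall k, 0 < `|p k| + `|x - p k|) ->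
  exists (phi : R -> R) (K L : R), [/\ forall v, gwo_sum_edensity a p x v = (phi v)%:E,
    forall v, 0 <= phi v <= K &
    forall v v', phi v <= phi v' + L * Num.sqrt `|v - v'|].
Proof.
move=> a0 px0.
have a0' := ltW a0.
have g0 k := gwo_edensity_ge0 a (p k) x.
have mg k := measurable_gwo_edensity a (p k) x.
pose mr k := mean_rsqrt a (p k) x.
have mrfin k : mr k \is a fin_num.
  by rewrite ge0_fin_numE ?mean_rsqrt_ge0//; exact: mean_rsqrt_lty.
pose G := convolution (gwo_edensity a (p 0) x) (gwo_edensity a (p 1) x).
have G0 z : (0 <= G z)%E by exact: convolution_ge0.
have mG : measurable_fun setT G by exact: measurable_convolution.
pose K := fine (2^-1%:E * mr 1%R * mr 0%R)%E.
have GK z : (G z <= K%:E)%E.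
  by rewrite fineK ?fin_numM//; exact: convolution_gwo_bound.
have K0 : 0 <= K by rewrite -lee_fin (le_trans (G0 0)).
have HC v : gwo_sum_edensity a p x v = convolution (gwo_edensity a (p 2) x) G v.
  by rewrite /gwo_sum_edensity convolutionC.
have [||| phi ?] := @fine_holder R (gwo_sum_edensity a p x) K (K * fine (mr 2)).
- by move=> v; rewrite HC; exact: convolution_ge0.
- move=> v; rewrite HC; apply: le_trans (convolution_le _ _ _ _ _ GK) _ => //.
  by rewrite -[leRHS]mule1 lee_wpmul2l ?lee_fin// integral_gwo_edensity_le1.
- move=> v v'; rewrite !HC.
  apply: le_trans (convolution_gwo_holder (p 2) x v v' a0' mG G0 GK) _.
  by rewrite mulrAC [in leRHS]EFinM fineK.
by exists phi, K, (K * fine (mr 2)).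
Qed.

Lemma gwo_sum_edensity_support (R : realType) (a : R) (p : 'I_3 -> R) (x v : R) :
  0 < a -> (forall k, 0 < `|p k| + `|x - p k|) ->
  (0 < gwo_sum_edensity a p x v)%E =
  (`|v - \sum_(k < 3) p k| < \sum_(k < 3) gwo_radius a (p k) x).
Proof.
move=> a0 px0.
have g0 k := gwo_edensity_ge0 a (p k) x.
have mg k := measurable_gwo_edensity a (p k) x.
have sg k := gwo_edensity_support a0 (px0 k).
have n0 k : 0 < gwo_radius a (p k) x by rewrite mulr_gt0.
have n01 : 0 < gwo_radius a (p 0) x + gwo_radius a (p 1) x by rewrite addr_gt0.
have s3 (F : 'I_3 -> R) : \sum_(k < 3) F k = F 0 + F 1 + F 2.
  rewrite !big_ord_recl big_ord0 addr0.
  have -> : lift ord0 (lift ord0 ord0) = 2 :> 'I_3 by exact: val_inj.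
  have -> : lift ord0 ord0 = 1 :> 'I_3 by exact: val_inj.
  by rewrite addrA.
have s01 := ball_support_convolution (mg 0) (mg 1) (g0 0) (g0 1) (n0 0) (n0 1) (sg 0) (sg 1).
have m01 := measurable_convolution (mg 0) (mg 1) (g0 0) (g0 1).
have G0 z : (0 <= convolution (gwo_edensity a (p 0%R) x) (gwo_edensity a (p 1%R) x) z)%E.
  exact: convolution_ge0.
rewrite !s3; have [h|h] := ltP `|v - (p 0 + p 1 + p 2)|.
  exact: (convolution_gt0 m01 (mg 2) G0 (g0 2) n01 (n0 2) s01 (sg 2) h).
by rewrite /gwo_sum_edensity (convolution_eq0 m01 (mg 2) s01 (sg 2) h) ltxx.
Qed.

Lemma gwo_a_gt0 (R : realType) (t tmax : nat) : (t < tmax)%N -> 0 < gwo_a R t tmax.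
Proof.
move=> tt; rewrite mulr_gt0// subr_gt0 ltr_pdivrMr ?mul1r ?ltr_nat//.
by rewrite ltr0n (leq_ltn_trans _ tt).
Qed.

Lemma ltr_norm_mul3 (R : realType) (u S N : R) :
  (`|3 * u - S| < N) = (3^-1 * S - 3^-1 * N < u < 3^-1 * S + 3^-1 * N).
Proof. by rewrite ltr_norml; apply/idP/idP; lra. Qed.

Theorem corollary2p1 (R : realType) (d : measure_display)
    (Omega : measurableType d) (P : probability Omega R)
    (t tmax : nat) (ht1 : (1 <= t)%N) (htmax : (t < tmax)%N)
    (p : 'I_3 -> R) (x : R) (A C : 'I_3 -> {RV P >-> R})
    (hA : forall k, uniformly_distributed (A k) (- gwo_a R t tmax) (gwo_a R t tmax))
    (hC : forall k, uniformly_distributed (C k) 0 2)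
    (hind : mutually_independent
              (fun i : 'I_3 + 'I_3 => match i with inl k => A k | inr k => C k end))
    (hn : forall k, 0 < gwo_radius (gwo_a R t tmax) (p k) x) :
  (exists g : 'I_3 -> R -> R,
     forall k, has_density P (gwo_summand (p k) x (A k) (C k)) (g k)) /\
  (forall g : 'I_3 -> R -> R,
     (forall k, has_density P (gwo_summand (p k) x (A k) (C k)) (g k)) ->
     exists h : R -> R,
       [/\ forall u, mean_density g u = (h u)%:E,
           has_density P (gwo_update p x A C) h,
           continuous h,
           bounded_fun h &
           [set u | 0 < h u] =
             (`] 3^-1 * (\sum_(k < 3) p k)
                  - 3^-1 * (\sum_(k < 3) gwo_radius (gwo_a R t tmax) (p k) x),
                3^-1 * (\sum_(k < 3) p k)
                  + 3^-1 * (\sum_(k < 3) gwo_radius (gwo_a R t tmax) (p k) x) [)%classic ]).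
Proof.
set a := gwo_a R t tmax in hA hn *.
have a0 : 0 < a by exact: gwo_a_gt0.
have px0 k : 0 < `|p k| + `|x - p k| by have := hn k; rewrite pmulr_rgt0.
have indep : mutually_independent (all_parameters A C) by exact: hind.
have dA k : has_edensity P (A k) (EFin \o uniform_pdf (- a) a).
  have [aa hAk] := hA k; split.
  - exact: measurable_funP.
  - by apply/measurable_EFinP; exact: measurable_uniform_pdf.
  - by move=> z; rewrite lee_fin uniform_pdf_nneg.
  - by move=> B mB; exact: hAk.
have dC k : has_edensity P (C k) (EFin \o uniform_pdf 0 2).
  have [aa hCk] := hC k; split.
  - exact: measurable_funP.
  - by apply/measurable_EFinP; exact: measurable_uniform_pdf.
  - by move=> z; rewrite lee_fin uniform_pdf_nneg.
  - by move=> B mB; exact: hCk.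
have dX k : has_edensity P (gwo_summand (p k) x (A k) (C k)) (gwo_edensity a (p k) x).
  apply: gwo_summand_edensity => // B1 B2 mB1 mB2.
  exact: (indep_CA k indep).
split.
  by exists (fun k => fine \o gwo_edensity a (p k) x) => k; exact: edensity_density.
move=> g hg.
have [phi [K [L [phiE phiK phiL]]]] := gwo_sum_edensity_regular a0 px0.
have gE k : ae_eq mu setT (EFin \o g k) (gwo_edensity a (p k) x).
  exact: edensity_ae_unique ((has_density_edensity _ _ _).1 (hg k)) (dX k).
have mg k : measurable_fun setT (EFin \o g k).
  by have [_ + _ _] := hg k; move/measurable_EFinP.
have mg' k := measurable_gwo_edensity a (p k) x.
have g0' k := gwo_edensity_ge0 a (p k) x.
have mdE u : mean_density g u = (3 * phi (3 * u))%:E.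
  rewrite /mean_density EFinM -phiE /gwo_sum_edensity.
  rewrite (convolution_ae_eq (mg 0) (mg 1) (mg' 0) (mg' 1) (gE 0) (gE 1)).
  have m01 := measurable_convolution (mg' 0) (mg' 1) (g0' 0) (g0' 1).
  by rewrite (convolution_ae_eq m01 (mg 2) m01 (mg' 2) (ae_eq_refl _ _ _) (gE 2)).
exists (fun u => 3 * phi (3 * u)); split => //.
- apply/has_density_edensity.
  rewrite (_ : EFin \o _ = mean_density g); last by apply/funext => u /=; rewrite mdE.
  exact: gwo_update_edensity.
- apply: (@holder_continuous R _ (3 * (L * Num.sqrt 3))) => u u'.
  move: (phiL (3 * u) (3 * u')).
  rewrite -mulrBr normrM (ger0_norm (ler0n R 3)) sqrtrM// => h.
  have -> : 3 * phi (3 * u') + 3 * (L * Num.sqrt 3) * Num.sqrt `|u - u'| =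
      3 * (phi (3 * u') + L * (Num.sqrt 3 * Num.sqrt `|u - u'|)) by ring.
  by rewrite ler_wpM2l.
- exists (3 * K); split; first exact: num_real.
  move=> y Ky u _ /=; apply: le_trans (ltW Ky).
  have /andP[phi0 phi1] := phiK (3 * u).
  by rewrite ger0_norm ?mulr_ge0// ler_wpM2l.
- apply/seteqP; split => u /=; rewrite in_itv/= pmulr_rgt0// -(lte_fin 0) -phiE;
    by rewrite gwo_sum_edensity_support// ltr_norm_mul3.
Qed.
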